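(* Let $q\in(0,1)$ and let $\sigma=(\sigma_1,\sigma_2,\ldots)\in\{+1,-1\}^\infty$ contain infinitely many $+1$'s and infinitely many $-1$'s. The Martin boundary of the symmetric $q$-Gelfand–Tsetlin graph associated to $\sigma$ is in bijection with the set $\mathfrak X$, under the map $\mathbf t\mapsto\{M^{\mathbf t}_N\}_{N\ge1}$.
   Context: $\mathbb{GT}_N$ is the set of signatures $\lambda=(\lambda_1\ge\cdots\ge\lambda_N)\in\mathbb Z^N$; $s_\lambda(x_1,\ldots,x_N)=\det[x_i^{\lambda_j+N-j}]_{i,j=1}^N/\prod_{i<j}(x_i-x_j)$. $\mathfrak X$ is the set of doubly infinite nondecreasing integer sequences $\mathbf t=(\cdots\le t_{-1}\le t_0\le t_1\le\cdots)$. Put $b(n)=\#\{1\le i\le n:\sigma_i=-1\}$. Symmetric $q$-Gelfand–Tsetlin graph associated to $\sigma$: the sequence $\{\mathbb{GT}_N,\Lambda^{N+1}_N\}_{N\ge1}$, where for $\lambda\in\mathbb{GT}_{N+1}$ the numbers $\Lambda^{N+1}_N(\lambda,\mu)$, $\mu\in\mathbb{GT}_N$, are the unique coefficients in $$\frac{s_\lambda(x_1,\ldots,x_N,q^{-N})}{s_\lambda(1,q^{-1},\ldots,q^{-N})}=\sum_{\mu\in\mathbb{GT}_N}\Lambda^{N+1}_N(\lambda,\mu)\frac{s_\mu(x_1,\ldots,x_N)}{s_\mu(1,q^{-1},\ldots,q^{1-N})}\quad\text{if }\sigma_{N+1}=-1,$$ $$\frac{s_\lambda(x_1,\ldots,x_N,q^{N})}{s_\lambda(1,q,\ldots,q^{N})}=\sum_{\mu\in\mathbb{GT}_N}\Lambda^{N+1}_N(\lambda,\mu)\frac{s_\mu(x_1,\ldots,x_N)}{s_\mu(1,q,\ldots,q^{N-1})}\quad\text{if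 }\sigma_{N+1}=+1.$$ These matrices are stochastic. For $N>k$, $\Lambda^N_k=\Lambda^N_{N-1}\cdots\Lambda^{k+1}_k$. A coherent system is a sequence of probability measures $M_N$ on $\mathbb{GT}_N$, $N\ge1$, with $M_{N+1}\Lambda^{N+1}_N=M_N$ for all $N$. The Martin boundary is the set of coherent systems $\{M_k\}_{k\ge1}$ for which there exists a sequence $\{\lambda(N)\in\mathbb{GT}_N\}_{N\ge1}$ with $M_k(\mu)=\lim_{N\to\infty}\Lambda^N_k(\lambda(N),\mu)$ for all $k\ge1$, $\mu\in\mathbb{GT}_k$. A sequence $\{\lambda(N)\in\mathbb{GT}_N\}$ $\mathbf b$-stabilizes to $\mathbf t$ if $\lim_{N\to\infty}\lambda(N)_{b(N)+1-i}=t_i$ for all $i\in\mathbb Z$. For $\mathbf t\in\mathfrak X$, $M^{\mathbf t}_k(\mu)=\lim_{N\to\infty}\Lambda^N_k(\lambda(N),\mu)$ for any $\{\lambda(N)\}$ that $\mathbf b$-stabilizes to $\mathbf t$ (the limit exists, does not depend on the sequence, and $\{M^{\mathbf t}_k\}_{k\ge1}$ is a coherent system of probability measures). *)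

(* Defs.v *)
From HB Require Import structures.
From mathcomp Require Import all_boot all_order all_algebra.
From mathcomp Require Import all_classical all_reals all_analysis.

Set Implicit Arguments.
Unset Strict Implicit.
Unset Printing Implicit Defensive.

Import Order.TTheory GRing.Theory Num.Theory numFieldNormedType.Exports.
Local Open Scope classical_set_scope.
Local Open Scope ring_scope.

Record GT (N : nat) := Signature {
  parts :> N.-tuple int;
  parts_sorted : sorted >=%R parts }.

HB.instance Definition _ N := [isSub for @parts N].
HB.instance Definition _ N := [Countable of GT N by <:].

(* The part lambda_j with the 1-based index j; the value 0 outside
   1 <= j <= N is irrelevant, as only limits N -> oo are taken below. *)
Definition part N (lam : GT N) (j : int) : int :=
  if j is Posz k.+1 then nth 0 lam k else 0.

(* The exponent is lambda_j + N - j for the 1-based index j.  The quotient is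
   the Laurent polynomial s_lambda at points x with nonzero, pairwise distinct
   coordinates, the only ones at which it is used. *)
Definition schur (F : fieldType) N (lam : GT N) (x : N.-tuple F) : F :=
  \det (\matrix_(i < N, j < N) tnth x i ^ (tnth lam j + (N - j.+1)%:Z))
  / \prod_(i < N) \prod_(j < N | (i < j)%N) (tnth x i - tnth x j).

Definition geom_tuple (F : fieldType) (p : F) N : N.-tuple F :=
  [tuple p ^+ i | i < N].

Section QGelfandTsetlin.
Variable R : realType.
Variable q : R.
(* sigma i is sigma_i for i >= 1; sigma 0 is never used. *)
Variable sigma : nat -> int.

(* c is the family of coefficients mu |-> Lambda^{N+1}_N(lam, mu); the cases
   sigma_{N+1} = -1 and +1 correspond to p = q^-1 and p = q.  The identity of
   Laurent polynomials is required at all x for which x_1, ..., x_N, p^N are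
   nonzero and pairwise distinct, which determines it. *)
Definition is_link_row (p : R) N (lam : GT N.+1) (c : GT N -> R) : Prop :=
  finite_set [set mu | c mu != 0] /\
  forall x : N.-tuple R, 0 \notin (x : seq R) -> uniq (rcons x (p ^+ N)) ->
    schur lam [tuple of rcons x (p ^+ N)] / schur lam (geom_tuple p N.+1)
    = \sum_(mu \in [set: GT N])
        c mu * (schur mu x / schur mu (geom_tuple p N)).

(* Lambda^{N+1}_N *)
Definition link N (lam : GT N.+1) : GT N -> R :=
  xget (fun=> 0) [set c | is_link_row (q ^ sigma N.+1) lam c].

(* Lambda^{m+k}_k; all sums have finitely many nonzero terms. *)
Fixpoint links k m : GT (m + k) -> GT k -> R :=
  match m return GT (m + k) -> GT k -> R with
  | 0 => fun lam mu => (lam == mu)%:R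
  | m'.+1 => fun lam mu =>
      \sum_(nu \in [set: GT (m' + k)]) link lam nu * @links k m' nu mu
  end.

(* A family of mass functions; M N lives on level N.+1, so that the levels
   are 1, 2, 3, ... *)
Definition system := forall N : nat, GT N.+1 -> R.

Definition coherent (M : system) : Prop :=
  [/\ forall N mu, 0 <= M N mu,
      forall N, \esum_(mu in [set: GT N.+1]) (M N mu)%:E = 1%E
    & forall N (mu : GT N.+1),
        \esum_(lam in [set: GT N.+2]) (M N.+1 lam * link lam mu)%:E
        = (M N mu)%:E].

(* Here and below, N = m + k with m -> oo; the term lam 0 of the sequence
   plays no role. *)
Definition martin_boundary : set system :=
  [set M | coherent M /\
    exists lam : forall N, GT N, forall k (mu : GT k.+1),
      @links k.+1 m (lam (m + k.+1)%N) mu @[m --> \oo] --> M k mu].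

Definition b (n : nat) : nat := (\sum_(1 <= i < n.+1) (sigma i == (-1)%R))%N.

(* Convergence of a sequence of integers means that it is eventually constant. *)
Definition b_stabilizes (lam : forall N, GT N) (t : int -> int) : Prop :=
  forall i : int,
    \forall N \near \oo, part (lam N) ((b N)%:Z + 1 - i) = t i.

Definition Mt (t : int -> int) : system := fun k mu =>
  get [set l : R | forall lam : forall N, GT N, b_stabilizes lam t ->
    @links k.+1 m (lam (m + k.+1)%N) mu @[m --> \oo] --> l].

End QGelfandTsetlin.

Definition frakX : set (int -> int) := [set t | {homo t : i j / i <= j}].

(* Main.v *)
Require Import Defs.
From mathcomp Require Import all_boot all_order all_algebra all_fingroup.
From mathcomp Require Import all_classical all_reals all_analysis.
From mathcomp Require Import zify lra.
Set Implicit Arguments.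
Unset Strict Implicit.
Unset Printing Implicit Defensive.
Import Order.TTheory GRing.Theory Num.Theory numFieldNormedType.Exports.
Local Open Scope classical_set_scope.
Local Open Scope ring_scope.

(** The links are read as a Markov chain that goes down from level N to level 1.

    By the branching rule (schur_rcons) and the linear independence of Schur
    functions (alternants_free), the link from lam to mu vanishes unless mu
    interlaces with lam, and is otherwise an explicit product: a power of q times
    a Vandermonde product in the powers of q (linkE). In a step with sigma = 1
    the weight drives every part mu_j to its largest value lam_j, in a step with
    sigma = -1 to its smallest value lam_(j+1). Give the part lambda_j at level N
    the label b(N) + 1 - j: in steps of both kinds the favoured value of a part is
    the part with the same label one level up. A displacement by m of a part at
    distance g from the edge that loses a part costs a factor of order q ^ (g m)
    (link_row_freeze), so that all parts at distance at least g stay in place with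
    probability at least exp (- const * q ^ g), uniformly in the starting point
    (frozen_prob). As both signs occur infinitely often, the distances of a label
    from the two edges grow with the level, and these errors are summable along
    the chain (expects_agree): with probability close to 1, the parts with given
    labels do not change at all between level N and a high fixed level.

    Conversely the other parts do not matter. The bound of expects_agree stays
    positive when the window of labels is the whole of a level. Hence two
    starting points that agree on a large window reach a common state at an
    intermediate level with probability bounded below; repeating this at
    successive levels couples the two chains (window_osc_step, window_osc_small).
    It follows that along any sequence that stabilizes to t the laws at level k are
    Cauchy in total variation, with a limit that depends only on t
    (stabilizing_approx, law_cvg); total variation gives that the limits are
    probability measures and form a coherent system (limit_system_coherent).

    If M is a coherent system obtained along some sequence lam(N), the part with
    label i of lam(N) is, for N large, the one that carries most of the mass of the
    part with label i under M at a high fixed level (label_determined). So these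
    parts are eventually constant, lam(N) stabilizes to some t, and M is the
    system of t; the same fact recovers t from M (labels_agree). *)

(** * Signatures and interlacing *)

Lemma GT_geP N (lam : GT N) i j : (i <= j < N)%N -> lam`_j <= lam`_i.
Proof.
move=> /andP[ij jN]; have sz : size lam = N by rewrite size_tuple.
have tr : transitive (>=%R : rel int) by move=> a b c ab bc; apply: le_trans bc ab.
have := @sorted_leq_nth _ (>=%R : rel int) tr (fun x => lexx x) 0 lam (parts_sorted lam).
by move=> /(_ i j); rewrite !inE sz; apply => //; apply: leq_ltn_trans ij jN.
Qed.

Definition GT0 N : GT N.
Proof.
apply: (@Signature N (nseq_tuple N 0)) => /=.
by elim: N => [|[|N]] //= ->; rewrite lexx.
Defined.

(** The zero signature is the value at a family h that is not nonincreasing. *)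
Definition mkGT N (h : 'I_N -> int) : GT N := insubd (GT0 N) [tuple h i | i < N].

Lemma mkGTE N (h : 'I_N -> int) (j : 'I_N) :
  (forall i j : 'I_N, (i <= j)%N -> h j <= h i) -> tnth (mkGT h) j = h j.
Proof.
move=> hm; suff -> : (mkGT h : N.-tuple int) = [tuple h i | i < N] by rewrite tnth_mktuple.
rewrite /mkGT -[parts _]/(val _) insubdK // unfold_in.
apply/(sortedP 0) => i; rewrite size_tuple => iN.
have i0 : (i < N)%N by apply: ltn_trans iN.
have := hm (Ordinal i0) (Ordinal iN) (leqnSn i).
rewrite -[X in nth 0 _ X]/(nat_of_ord (Ordinal i0)).
rewrite -[X in _ -> nth 0 _ X <= _]/(nat_of_ord (Ordinal iN)).
by rewrite -!tnth_nth !tnth_mktuple.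
Qed.

Lemma GT_ext N (lam mu : GT N) : (forall j, tnth lam j = tnth mu j) -> lam = mu.
Proof. by move=> h; apply/val_inj/eq_from_tnth. Qed.

Definition weight N (lam : GT N) : int := \sum_i tnth lam i.

Definition interlaces N (lam : GT N.+1) (mu : GT N) : bool :=
  [forall j : 'I_N, lam`_j.+1 <= tnth mu j <= lam`_j].

Definition spread N (lam : GT N.+1) : nat := `|(lam`_0 - lam`_N)%R|%N.

(** The signatures below lam form a box, parametrized by the distances of the
    coordinates from their smallest values; the bound spread lam on all these
    distances makes the box a family of finite functions, over which a product
    of sums can be expanded. *)
Definition below N (lam : GT N.+1) : seq (GT N) :=
  [seq mkGT (fun i => lam`_i.+1 + (f i)%:Z) | f : {ffun 'I_N -> 'I_(spread lam).+1}
    <- enum (family (fun (j : 'I_N) (d : 'I_(spread lam).+1) =>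
                       lam`_j.+1 + d%:Z <= lam`_j))].

Section Below.
Variables (N : nat) (lam : GT N.+1).
Let D := (spread lam).+1.
Let box := family (fun (j : 'I_N) (d : 'I_D) => lam`_j.+1 + d%:Z <= lam`_j).

Lemma boxE (f : {ffun 'I_N -> 'I_D}) j : f \in box ->
  tnth (mkGT (fun i => lam`_i.+1 + (f i)%:Z)) j = lam`_j.+1 + (f j)%:Z.
Proof.
move=> /familyP hf; rewrite mkGTE // => i k ik.
have [->//|ne] := eqVneq i k.
have := hf k; rewrite unfold_in => h1.
apply: (le_trans h1); apply: (@le_trans _ _ lam`_i.+1); last by rewrite lerDl.
apply: GT_geP; rewrite ltn_neqAle ik (ltn_trans (ltn_ord k)) ?andbT //.
Qed.

Lemma mem_below mu : (mu \in below lam) = interlaces lam mu.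
Proof.
apply/idP/forallP => [/mapP[f + ->] j|h].
  rewrite mem_enum => fb.
  rewrite boxE // lerDl lez_nat leq0n /=.
  by have /familyP/(_ j) := fb; rewrite unfold_in.
have hD (j : 'I_N) : (`|(tnth mu j - lam`_j.+1)%R| < D)%N.
  have /andP[h1 h2] := h j.
  have h3 : lam`_j <= lam`_0 by apply: GT_geP; rewrite /= ltnS ltnW.
  have h4 : lam`_N <= lam`_j.+1 by apply: GT_geP; rewrite ltn_ord ltnSn.
  rewrite /D /spread; lia.
pose f : {ffun 'I_N -> 'I_D} := [ffun j => Ordinal (hD j)].
have fE (j : 'I_N) : lam`_j.+1 + (f j)%:Z = tnth mu j.
  rewrite ffunE /=; have /andP[h1 h2] := h j.
  by rewrite gez0_abs ?subr_ge0 // addrC subrK.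
have fb : f \in box.
  by apply/familyP => j; rewrite unfold_in fE; case/andP: (h j).
by apply/mapP; exists f; rewrite ?mem_enum //; apply: GT_ext => j; rewrite boxE // fE.
Qed.

Lemma below_uniq : uniq (below lam).
Proof.
rewrite map_inj_in_uniq ?enum_uniq // => f g; rewrite !mem_enum => fb gb fg.
apply/ffunP => j; apply: val_inj => /=.
by have := boxE j fb; rewrite fg boxE // => /addrI[].
Qed.

End Below.

Lemma big_below (V : nmodType) N (lam : GT N.+1) (F : GT N -> V) :
  \sum_(nu <- below lam) F nu =
  \sum_(f in family (fun (j : 'I_N) (d : 'I_(spread lam).+1) =>
                       lam`_j.+1 + d%:Z <= lam`_j))
    F (mkGT (fun i => lam`_i.+1 + (f i)%:Z)).
Proof. by rewrite /below big_map big_enum. Qed.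

(** * The branching rule of Schur functions *)

Definition alternant (F : fieldType) N (lam : GT N) (x : N.-tuple F) : F :=
  \det (\matrix_(i < N, j < N) tnth x i ^ (tnth lam j + (N - j.+1)%:Z)).

Lemma geom_exprz (F : fieldType) (x z : F) (a : int) (h : nat) : x != 0 ->
  x ^ (a + h.+1%:Z) - z ^+ h.+1 * x ^ a =
  (x - z) * \sum_(d < h.+1) x ^ (a + d%:Z) * z ^+ (h - d).
Proof.
move=> x0; rewrite expfzDr // -exprnP [z ^+ _ * _]mulrC -mulrBr.
rewrite -opprB subrXX -[z - x]opprB !mulNr opprK mulrCA; congr (_ * _).
rewrite mulr_sumr; apply: eq_bigr => i _.
by rewrite expfzDr // mulrCA [RHS]mulrC mulrA /= mulrAC mulrC.
Qed.

Lemma prod_exprz (F : fieldType) (I : Type) (r : seq I) (P : pred I) (a : I -> int)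
  (z : F) : z != 0 -> \prod_(i <- r | P i) z ^ a i = z ^ (\sum_(i <- r | P i) a i).
Proof.
by move=> z0; rewrite (big_morph (exprz z) (fun a b => expfzDr a b z0) (expr0z z)).
Qed.

Lemma sum_mul_delta (R : pzRingType) (I : finType) (k : I) (F : I -> R) :
  \sum_i F i * (i == k)%:R = F k.
Proof.
rewrite (bigD1 k) //= eqxx mulr1 big1 ?addr0 // => i /negPf ->.
by rewrite mulr0.
Qed.

Lemma tnth_lift_max (T : Type) N (x : N.-tuple T) z (i : 'I_N) :
  tnth [tuple of rcons x z] (lift ord_max i) = tnth x i.
Proof.
by rewrite (tnth_nth z) lift_max /= nth_rcons size_tuple ltn_ord -tnth_nth.
Qed.

Lemma tnth_ord_max (T : Type) N (x : N.-tuple T) z :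
  tnth [tuple of rcons x z] ord_max = z.
Proof. by rewrite (tnth_nth z) /= nth_rcons size_tuple ltnn eqxx. Qed.

Section Branching.
Variables (F : fieldType) (N : nat) (lam : GT N.+1) (x : N.-tuple F) (z : F).
Hypotheses (x0 : forall i, tnth x i != 0) (z0 : z != 0).

Let l (k : nat) : int := lam`_k + (N - k)%:Z.
Let h (j : nat) : nat := `|(lam`_j - lam`_j.+1)%R|%N.
Let hE j : (j < N)%N -> (h j)%:Z = lam`_j - lam`_j.+1.
Proof. by move=> jN; rewrite gez0_abs // subr_ge0 GT_geP // leqnSn. Qed.
Let lE j : (j < N)%N -> l j = l j.+1 + (h j).+1%:Z.
Proof. move=> jN; have := hE jN; rewrite /l; lia. Qed.

Let A := \matrix_(i < N.+1, j < N.+1)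
  tnth [tuple of rcons x z] i ^ (tnth lam j + (N.+1 - j.+1)%:Z).
Let AE i (j : 'I_N.+1) : A i j = tnth [tuple of rcons x z] i ^ l j.
Proof. by rewrite mxE [tnth lam j](tnth_nth 0). Qed.

(* Multiplication by B subtracts from each column the multiple of the next one
   that clears the entry in the row of z. *)
Let B : 'M[F]_N.+1 := \matrix_(i, j)
  ((i == j)%:R - (i == j.+1 :> nat)%:R * z ^ (l j - l j.+1)).

Let detB : \det B = 1.
Proof.
rewrite det_trig; last first.
  apply/is_trig_mxP => i j ij; rewrite mxE.
  by rewrite -val_eqE /= !ltn_eqF ?mul0r ?subr0 // ltnW.
by apply: big1 => i _; rewrite mxE eqxx ltn_eqF // mul0r subr0.
Qed.

Let AB_max i : (A *m B) i ord_max = A i ord_max.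
Proof.
rewrite mxE -[RHS](sum_mul_delta ord_max (A i)); apply: eq_bigr => k _.
by rewrite [B _ _]mxE [k == _.+1 :> nat]ltn_eqF ?mul0r ?subr0.
Qed.

Let eq_lift0 (k : 'I_N.+1) (j : 'I_N) : (k == lift ord0 j) = (k == j.+1 :> nat).
Proof. by rewrite -val_eqE. Qed.

Let AB_lift i (j : 'I_N) : (A *m B) i (lift ord_max j) =
  A i (lift ord_max j) - z ^+ (h j).+1 * A i (lift ord0 j).
Proof.
rewrite mxE -(sum_mul_delta (lift ord_max j) (A i)).
rewrite -(sum_mul_delta (lift ord0 j) (A i)) mulr_sumr -sumrB.
apply: eq_bigr => k _; rewrite [B _ _]mxE lift_max mulrBr; congr (_ - _).
rewrite eq_lift0 lE // addrAC subrr add0r.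
by rewrite -exprnP [_%:R * _]mulrC mulrCA.
Qed.

Let M := \matrix_(i < N, j < N)
  \sum_(d < (h j).+1) tnth x i ^ (l j.+1 + d%:Z) * z ^+ (h j - d).

Let minorE : row' ord_max (col' ord_max (A *m B)) =
  \matrix_(i, j) ((tnth x i - z) * M i j).
Proof.
apply/matrixP => i j; rewrite mxE [LHS]mxE [RHS]mxE [M i j]mxE.
by rewrite AB_lift !AE tnth_lift_max lift_max lift0 -geom_exprz // -lE.
Qed.

Let det_reduce : \det A = \prod_i (tnth x i - z) * (z ^ l N * \det M).
Proof.
have -> : \det A = \det (A *m B) by rewrite det_mulmx detB mulr1.
rewrite (expand_det_row _ ord_max) (bigD1 ord_max) //= big1 ?addr0; last first.
  move=> j; case: (unliftP ord_max j) => [k ->|->]; last by rewrite eqxx.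
  rewrite AB_lift !AE tnth_ord_max lift_max lift0 (lE (ltn_ord k)) expfzDr //.
  by rewrite [X in X - _]mulrC subrr mul0r.
rewrite AB_max AE tnth_ord_max /cofactor addnn -signr_odd odd_double expr0 mul1r.
rewrite minorE mulrCA; congr (_ * _).
rewrite /determinant [RHS]big_distrr; apply: eq_bigr => s _ /=.
by under eq_bigr do rewrite mxE; rewrite big_split /= mulrCA.
Qed.

Let Q (j : 'I_N) (d : 'I_(spread lam).+1) := lam`_j.+1 + d%:Z <= lam`_j.

Let det_expand : z ^ l N * \det M =
  \sum_(f in family Q)
     z ^ (l N + \sum_(j < N) ((h j)%:Z - (f j)%:Z)) *
     \det (\matrix_(i, j) tnth x i ^ (l j.+1 + (f j)%:Z)).
Proof.
have entry i (j : 'I_N) : M i j =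
    \sum_(d in Q j) tnth x i ^ (l j.+1 + d%:Z) * z ^ ((h j)%:Z - d%:Z).
  have hD : ((h j).+1 <= (spread lam).+1)%N.
    have h3 : lam`_j <= lam`_0 by apply: GT_geP; rewrite /= ltnS ltnW.
    have h4 : lam`_N <= lam`_j.+1 by apply: GT_geP; rewrite ltn_ord ltnSn.
    have := hE (ltn_ord j); rewrite /spread; lia.
  rewrite mxE (big_ord_widen _ (fun d => tnth x i ^ (l j.+1 + d%:Z) * z ^+ (h j - d)) hD).
  apply: eq_big => d; last by move=> hd; rewrite exprnP subzn.
  by have hj := hE (ltn_ord j); rewrite [RHS]unfold_in /Q; apply/idP/idP; lia.
rewrite -det_tr mulr_sumr.
under eq_bigr => s _.
  under eq_bigr do rewrite mxE entry.
  rewrite bigA_distr_big_dep /= mulrCA !mulr_sumr.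
  over.
rewrite exchange_big /=; apply: eq_bigr => f _.
rewrite -det_tr [RHS]mulr_sumr; apply: eq_bigr => s _.
rewrite [in LHS]big_split /= expfzDr // -prod_exprz //.
under [X in _ = _ * (_ * X)]eq_bigr do rewrite mxE mxE.
rewrite -!mulrA mulrCA; congr (_ * _).
by rewrite [X in _ * X]mulrC mulrCA.
Qed.

(** After the column operations the row of z has one nonzero entry left, and the
    remaining entries are x - z times geometric sums over the intervals
    [lam_(j+1), lam_j]; expanding the product of these sums over the columns gives
    one alternant for each signature in the box below lam. *)
Theorem alternant_rcons :
  alternant lam [tuple of rcons x z] =
  \prod_i (tnth x i - z) *
  \sum_(nu <- below lam) z ^ (weight lam - weight nu) * alternant nu x.
Proof.
rewrite [LHS]det_reduce; congr (_ * _); rewrite det_expand big_below.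
apply: eq_bigr => f fQ; rewrite /alternant; congr (_ * _); last first.
  congr (\det _); apply/matrixP => i j; rewrite !mxE boxE //; congr (_ ^ _).
  by rewrite /l addrAC.
have -> : weight lam = \sum_(j < N) lam`_j + lam`_N.
  by rewrite /weight; under eq_bigr do rewrite (tnth_nth 0); rewrite big_ord_recr.
congr (z ^ _); rewrite /weight [RHS]addrAC -sumrB /l subnn addr0 addrC.
congr (_ + _); apply: eq_bigr => j _; rewrite boxE // hE //.
by rewrite opprD addrA.
Qed.

End Branching.

Definition vdm (F : fieldType) N (x : N.-tuple F) : F :=
  \prod_(i < N) \prod_(j < N | (i < j)%N) (tnth x i - tnth x j).

Lemma schurE (F : fieldType) N (lam : GT N) (x : N.-tuple F) :
  schur lam x = alternant lam x / vdm x.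
Proof. by []. Qed.

Lemma vdm_rcons (F : fieldType) N (x : N.-tuple F) z :
  vdm [tuple of rcons x z] = vdm x * \prod_i (tnth x i - z).
Proof.
have W (i : 'I_N) : tnth [tuple of rcons x z] (widen_ord (leqnSn N) i) = tnth x i.
  rewrite -(tnth_lift_max x z); congr tnth; apply: val_inj.
  by rewrite /= /bump leqNgt ltn_ord.
rewrite /vdm big_ord_recr /= [X in _ * X]big_pred0 ?mulr1; last first.
  by move=> j; rewrite ltnNge -ltnS ltn_ord.
rewrite -big_split /=; apply: eq_bigr => i _.
rewrite big_mkcond big_ord_recr /= ltn_ord W tnth_ord_max; congr (_ * _).
by rewrite [RHS]big_mkcond; apply: eq_bigr => j _ /=; rewrite W.
Qed.

Lemma vdm_neq0 (F : fieldType) N (x : N.-tuple F) : uniq x -> vdm x != 0.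
Proof.
move=> ux; apply/prodf_neq0 => i _; apply/prodf_neq0 => j ij.
by rewrite subr_eq0 (inj_eq (tuple_uniqP _ ux)) -val_eqE /= ltn_eqF.
Qed.

Theorem schur_rcons (F : fieldType) N (lam : GT N.+1) (x : N.-tuple F) z :
  0 \notin (x : seq F) -> z \notin (x : seq F) -> z != 0 ->
  schur lam [tuple of rcons x z] =
  \sum_(nu <- below lam) z ^ (weight lam - weight nu) * schur nu x.
Proof.
move=> x0 xz z0; rewrite schurE alternant_rcons //; last first.
  by move=> i; apply: contraNneq x0 => <-; rewrite mem_tnth.
have pz : \prod_i (tnth x i - z) != 0.
  apply/prodf_neq0 => i _; rewrite subr_eq0.
  by apply: contraNneq xz => <-; rewrite mem_tnth.
rewrite vdm_rcons [vdm x * _]mulrC -mulf_div divff // mul1r mulr_suml.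
by apply: eq_bigr => nu _; rewrite schurE mulrA.
Qed.

Definition expo N (lam : GT N) (j : 'I_N) : int := tnth lam j + (N - j.+1)%:Z.

Lemma expo_lt N (lam : GT N) (i j : 'I_N) : (i < j)%N -> expo lam j < expo lam i.
Proof.
move=> ij; rewrite /expo !(tnth_nth 0).
have := @GT_geP _ lam i j; rewrite (ltnW ij) ltn_ord => /(_ isT).
move=> h; apply: ler_ltD => //; rewrite ltz_nat.
by rewrite ltn_sub2l // (leq_ltn_trans ij).
Qed.

Lemma expo_inj N (lam : GT N) : injective (expo lam).
Proof.
move=> i j; case: (ltngtP i j) => [/expo_lt h e|/expo_lt h e|/val_inj//].
  by have := h lam; rewrite e ltxx.
by have := h lam; rewrite e ltxx.
Qed.

Lemma schur_geom (F : fieldType) (p : F) N (lam : GT N) :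
  schur lam (geom_tuple p N) = 
  \prod_(i < N) \prod_(j < N | (i < j)%N)
    ((p ^ expo lam j - p ^ expo lam i) / (p ^+ i - p ^+ j)).
Proof.
rewrite schurE /alternant.
have -> : \matrix_(i < N, j < N) tnth (geom_tuple p N) i ^ (tnth lam j + (N - j.+1)%N)
  = Vandermonde N (\row_j p ^ expo lam j).
  by apply/matrixP => i j; rewrite !mxE tnth_mktuple !exprnP !exprz_exp mulrC.
rewrite det_Vandermonde /vdm -prodf_div; apply: eq_bigr => i _.
by rewrite -prodf_div; apply: eq_bigr => j _; rewrite !mxE !tnth_mktuple.
Qed.

(** * Uniqueness of the branching coefficients *)

Section Positivity.
Variable R : realType.

Lemma ltr_decrz (p : R) (a b : int) : 0 < p < 1 -> (p ^ a < p ^ b) = (b < a).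
Proof.
move=> /andP[p0 p1]; have p1' : 1 < p^-1 by rewrite invf_gt1.
have E c : p ^ c = p^-1 ^ (- c) by rewrite exprz_inv opprK.
by rewrite !E ltr_eXz2l // ltrN2.
Qed.

Lemma exprz_decr_sign (p : R) : 0 < p -> p != 1 ->
  forall (a b c d : int), b < a -> d < c -> 0 < (p ^ a - p ^ b) / (p ^ c - p ^ d).
Proof.
move=> p0 p1 a b c d ba dc; case/orP: (lt_total p1) => {}p1.
  by rewrite nmulr_rgt0 ?invr_lt0 subr_lt0 ltr_decrz ?p0.
by rewrite divr_gt0 ?subr_gt0 ?ltr_eXz2l.
Qed.

Lemma schur_geom_gt0 (p : R) N (lam : GT N) : 0 < p -> p != 1 ->
  0 < schur lam (geom_tuple p N).
Proof.
move=> p0 p1; rewrite schur_geom; apply: prodr_gt0 => i _; apply: prodr_gt0 => j ij.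
rewrite -[_ / _]opprK -mulNr -mulrN -invrN !opprB.
have ij' : i%:Z < j%:Z by rewrite ltz_nat.
exact: (exprz_decr_sign p0 p1 (expo_lt lam ij) ij').
Qed.

Definition sqnorm N (lam : GT N) : int := \sum_i expo lam i ^+ 2.

(** The rearrangement inequality, with its case of equality: exponents are strictly
    decreasing, so that a permutation of those of mu agrees with those of nu only
    if it is trivial and mu = nu. *)
Lemma dot_expo_lt N (nu mu : GT N) (s : 'S_N) : sqnorm mu <= sqnorm nu ->
  (nu, 1%g) != (mu, s) -> \sum_i expo nu i * expo mu (s i) < sqnorm nu.
Proof.
move=> le ne.
have sq : 0 <= \sum_i (expo nu i - expo mu (s i)) ^+ 2.
  by apply: sumr_ge0 => i _; rewrite sqr_ge0.
have sqE : \sum_i (expo nu i - expo mu (s i)) ^+ 2 =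
    sqnorm nu + sqnorm mu - (\sum_i expo nu i * expo mu (s i)) *+ 2.
  rewrite /sqnorm [X in _ + X - _](reindex_inj (@perm_inj _ s)) /=.
  rewrite -sumrMnl -big_split -sumrB /=; apply: eq_bigr => i _.
  by rewrite sqrrB addrAC.
move: sq; rewrite le_eqVlt => /orP[/eqP/esym/psumr_eq0P sq0|]; last first.
  by rewrite sqE; lia.
have e i : expo nu i = expo mu (s i).
  apply/eqP; rewrite -subr_eq0 -sqrf_eq0; apply/eqP/sq0 => // k _.
  by rewrite sqr_ge0.
have e2 : [tuple expo nu i | i < N] = [tuple expo mu i | i < N].
  have srt (la : GT N) : sorted >%R [tuple expo la i | i < N].
    apply/(sortedP 0) => i; rewrite size_tuple => iN.
    have i0 : (i < N)%N by apply: ltn_trans iN.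
    rewrite -[i.+1]/(nat_of_ord (Ordinal iN)).
    rewrite -[in nth _ _ i]/(nat_of_ord (Ordinal i0)).
    by rewrite -!tnth_nth !tnth_mktuple; apply: expo_lt.
  apply/val_inj/(@irr_sorted_eq _ >%R) => //.
  - by move=> a b c ab bc; apply: lt_trans bc ab.
  - by move=> a; apply: ltxx.
  - exact: srt.
  - exact: srt.
  move=> a; apply/tnthP/tnthP => -[i ->]; rewrite tnth_mktuple.
    by exists (s i); rewrite tnth_mktuple e.
  by exists (s^-1%g i); rewrite tnth_mktuple e permKV.
have e3 i : expo nu i = expo mu i.
  by have := congr1 (fun t => tnth t i) e2; rewrite !tnth_mktuple.
case/negP: ne; apply/eqP; congr (_, _).
  by apply: GT_ext => i; have := e3 i; rewrite /expo => /addIr.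
by apply/permP => i; rewrite perm1; apply: (@expo_inj _ mu); rewrite -e -e3.
Qed.

Lemma seq_argmax (T : eqType) (f : T -> int) (r : seq T) x : x \in r ->
  exists2 y, y \in r & forall z, z \in r -> f z <= f y.
Proof.
elim: r x => // a [_ x _|b l IH x _].
  by exists a => [|k]; rewrite inE // => /eqP ->.
have [y yl ymax] := IH b (mem_head _ _); have [h|h] := leP (f a) (f y).
  by exists y => [|k]; rewrite inE ?yl ?orbT // => /orP[/eqP->//|/ymax].
exists a => [|k]; rewrite ?mem_head // inE => /orP[/eqP->//|/ymax].
by move=> /le_trans; apply; apply: ltW.
Qed.

Definition power_tuple (y : R) N (nu : GT N) : N.-tuple R :=
  [tuple y ^ expo nu i | i < N].

Lemma alternant_power (y : R) N (nu mu : GT N) : y != 0 ->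
  alternant mu (power_tuple y nu) =
  \sum_(s : 'S_N) (-1) ^+ s * y ^ (\sum_i expo nu i * expo mu (s i)).
Proof.
move=> y0; apply: eq_bigr => s _; congr (_ * _); rewrite -prod_exprz //.
by apply: eq_bigr => i _; rewrite mxE tnth_mktuple exprz_exp.
Qed.

(** Among the signatures with nonzero coefficient take nu with the largest sum of
    squares of exponents. Along x_i = y ^ (expo nu i) the diagonal term of the
    alternant of nu is y to this sum of squares, and by the rearrangement
    inequality every other term is at least y times smaller; letting y grow
    contradicts the vanishing of the sum. *)
Lemma alternants_free N (r : seq (GT N)) (c : GT N -> R) (Y : R) : uniq r ->
  (forall y nu, Y < y -> 1 < y -> nu \in r ->
     \sum_(mu <- r) c mu * alternant mu (power_tuple y nu) = 0) ->
  forall mu, mu \in r -> c mu = 0.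
Proof.
move=> ur H mu mur; apply/eqP; apply: contraT => cmu.
pose r' := [seq nu <- r | c nu != 0].
have mur' : mu \in r' by rewrite mem_filter cmu.
have [nu nur' numax] := seq_argmax (@sqnorm N) mur'.
have [nur cnu] : nu \in r /\ c nu != 0 by move: nur'; rewrite mem_filter => /andP[].
pose f m (s : 'S_N) := `|c m|.
pose C := \sum_(mu <- r) \sum_s f mu s.
(* Large enough for c nu * y ^ K to exceed the sum of all the other terms. *)
pose y := 2 + `|Y| + C / `|c nu|.
have C0 : 0 <= C by apply: sumr_ge0 => k _; apply: sumr_ge0 => s _; apply: normr_ge0.
have Cc : 0 <= C / `|c nu| by rewrite divr_ge0.
have y1 : 1 < y by rewrite /y; have := normr_ge0 Y; lra.
have yY : Y < y by rewrite /y; have := ler_norm Y; lra.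
have y0 : 0 < y by apply: lt_trans y1.
pose K := sqnorm nu.
pose t m (s : 'S_N) := c m * ((-1) ^+ s * y ^ (\sum_i expo nu i * expo m (s i))).
have tE : \sum_(m <- r) \sum_s t m s = 0.
  rewrite -[RHS](H y nu yY y1 nur); apply: eq_bigr => m _.
  by rewrite alternant_power ?gt_eqF // mulr_sumr.
have tle m s : (nu, 1%g) != (m, s) -> m \in r ->
    `|t m s| <= `|c m| * y ^ (K - 1).
  move=> ne mr; rewrite /t normrM.
  have [->|cm] := eqVneq (c m) 0; first by rewrite normr0 !mul0r.
  rewrite ler_wpM2l // normrM normrX normrN1 expr1n mul1r gtr0_norm ?exprz_gt0 //.
  rewrite ler_eXz2l // lerBrDr -ltzD1 ltrD2r.
  by apply: dot_expo_lt => //; apply: numax; rewrite mem_filter cm.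
move: tE; rewrite (bigD1_seq nu) //= (bigD1 1%g) //=.
have -> : t nu 1%g = c nu * y ^ K.
  rewrite /t odd_perm1 expr0 mul1r /K /sqnorm; congr (_ * _ ^ _).
  by apply: eq_bigr => i _; rewrite perm1 expr2.
rewrite -addrA => /eqP; rewrite addr_eq0 => /eqP/(congr1 Num.norm).
rewrite normrN normrM [`|y ^ K|]gtr0_norm ?exprz_gt0 // => e.
have : `|c nu| * y ^ K <= C * y ^ (K - 1).
  rewrite e (le_trans (ler_normD _ _)) // /C.
  rewrite [X in _ <= X * _](bigD1_seq nu) //= [X in _ <= (X + _) * _](bigD1 1%g) //=.
  rewrite 2!mulrDl -addrA -[leLHS]add0r lerD //.
    by apply: mulr_ge0; [exact: normr_ge0 | apply: exprz_ge0; exact: ltW].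
  rewrite lerD // mulr_suml (le_trans (ler_norm_sum _ _ _)) //.
    by apply: ler_sum => s s1; apply: tle => //; rewrite xpair_eqE eqxx eq_sym.
  rewrite big_seq_cond [leRHS]big_seq_cond; apply: ler_sum => m /andP[mr mn].
  rewrite mulr_suml (le_trans (ler_norm_sum _ _ _)) //.
  by apply: ler_sum => s _; apply: tle => //; rewrite xpair_eqE eq_sym (negPf mn).
rewrite -[K in y ^ K](subrK 1) expfzDr ?gt_eqF // expr1z [_ * y]mulrC mulrA.
rewrite ler_pM2r ?exprz_gt0 // -ler_pdivlMl ?normr_gt0 // [_^-1 * _]mulrC.
by rewrite /y leNgt => /negP[]; have := normr_ge0 Y; lra.
Qed.

End Positivity.

(** * The links as explicit stochastic matrices *)

Lemma fsum_uniq_seq (V : nmodType) (I : choiceType) (r : seq I) (F : I -> V) :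
  uniq r -> (forall i, i \notin r -> F i = 0) ->
  \sum_(i \in [set: I]) F i = \sum_(i <- r) F i.
Proof.
move=> ur F0; rewrite [RHS]fsbig_seq //; symmetry.
apply: (fsbig_widen [set` r] setT) => //.
by move=> i [_ /= /negP ir]; exact: F0.
Qed.

Lemma geom_tupleS (F : fieldType) (p : F) N :
  geom_tuple p N.+1 = [tuple of rcons (geom_tuple p N) (p ^+ N)].
Proof.
apply: eq_from_tnth => i; rewrite tnth_mktuple; case: (unliftP ord_max i) => [j|] ->.
  by rewrite tnth_lift_max tnth_mktuple lift_max.
by rewrite tnth_ord_max.
Qed.

Section Links.
Variables (R : realType) (p : R).
Hypotheses (p0 : 0 < p) (p1 : p != 1).

Definition link_row N (lam : GT N.+1) (mu : GT N) : R :=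
  if interlaces lam mu then
    (p ^+ N) ^ (weight lam - weight mu) * schur mu (geom_tuple p N)
    / schur lam (geom_tuple p N.+1)
  else 0.

Lemma link_row_ge0 N (lam : GT N.+1) mu : 0 <= link_row lam mu.
Proof.
rewrite /link_row; case: ifP => // _.
have h1 := schur_geom_gt0 mu p0 p1; have h2 := schur_geom_gt0 lam p0 p1.
apply: divr_ge0 (ltW h2); apply: mulr_ge0 (ltW h1).
by apply: exprz_ge0; apply: exprn_ge0; exact: ltW.
Qed.

Lemma expr_inj_pos : injective (GRing.exp p).
Proof.
move=> i j e; case: (ltngtP i j) => // ij; exfalso.
  have := @exprz_decr_sign _ _ p0 p1 j i j i; rewrite !ltz_nat ij => /(_ isT isT).
  by rewrite -!exprnP e subrr mul0r ltxx.
have := @exprz_decr_sign _ _ p0 p1 i j i j; rewrite !ltz_nat ij => /(_ isT isT).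
by rewrite -!exprnP e subrr mul0r ltxx.
Qed.

Lemma geom_tuple_uniq N : uniq (geom_tuple p N).
Proof.
apply/tuple_uniqP => i j; rewrite !tnth_mktuple => /expr_inj_pos.
exact: val_inj.
Qed.

Lemma geom_tuple_neq0 N : 0 \notin (geom_tuple p N : seq R).
Proof.
apply/negP => /tnthP[i]; rewrite tnth_mktuple => /esym/eqP.
by rewrite expf_eq0 (gt_eqF p0) andbF.
Qed.

Lemma sum_link_row N (lam : GT N.+1) : \sum_(mu <- below lam) link_row lam mu = 1.
Proof.
have s0 : schur lam (geom_tuple p N.+1) != 0 by rewrite gt_eqF ?schur_geom_gt0.
apply: (mulIf s0); rewrite mul1r mulr_suml.
have := geom_tuple_uniq N.+1; rewrite {1}geom_tupleS rcons_uniq => /andP[pN _].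
rewrite [in RHS]geom_tupleS schur_rcons ?geom_tuple_neq0 ?expf_neq0 ?gt_eqF //.
apply: eq_big_seq => mu; rewrite mem_below => h.
by rewrite /link_row h divfK.
Qed.

Lemma link_row_is_link_row N (lam : GT N.+1) : is_link_row p lam (link_row lam).
Proof.
have out mu : mu \notin below lam -> link_row lam mu = 0.
  by rewrite mem_below /link_row => /negPf ->.
split.
  apply: (@sub_finite_set _ _ [set` below lam]); last exact: finite_seq.
  by move=> mu /=; apply: contraNT => /out ->.
move=> x x0; rewrite rcons_uniq => /andP[px ux].
rewrite (fsum_uniq_seq (below_uniq lam)); last by move=> mu /out ->; rewrite mul0r.
rewrite schur_rcons ?expf_neq0 ?gt_eqF // mulr_suml.
apply: eq_big_seq => mu; rewrite mem_below /link_row => ->.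
have h1 := schur_geom_gt0 mu p0 p1.
have alg (a g l s : R) : g != 0 -> a * s / l = a * g / l * (s / g).
  by move=> g0; rewrite -!mulrA [g * _]mulrC -!mulrA mulVf // mulr1 [s * _]mulrC.
by apply: alg; rewrite gt_eqF.
Qed.

(** The points of the form y ^ (expo nu i) with y large are distinct, nonzero and
    different from p ^ N, so the identities defining c and c' hold at them, and
    this suffices to separate the coefficients. *)
Lemma link_row_unique N (lam : GT N.+1) (c c' : GT N -> R) :
  is_link_row p lam c -> is_link_row p lam c' -> c = c'.
Proof.
move=> [fc ec] [fc' ec'].
have /finite_seqP[r rE] := fc; have /finite_seqP[r' rE'] := fc'.
pose s := undup (r ++ r').
have us : uniq s := undup_uniq _.
have out mu : mu \notin s -> c mu = 0 /\ c' mu = 0.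
  rewrite mem_undup mem_cat negb_or => /andP[/negP h /negP h']; split; apply: contrapT.
    by move=> /eqP cn; apply: h; have : [set mu | c mu != 0] mu by []; rewrite rE.
  by move=> /eqP cn; apply: h'; have : [set mu | c' mu != 0] mu by []; rewrite rE'.
pose d mu := (c mu - c' mu) / schur mu (geom_tuple p N).
have d0 mu : mu \in s -> d mu = 0.
  apply: (@alternants_free _ _ _ d (p ^+ N + p ^- N)) => // y nu yY y1 nus.
  have y0 : 0 < y by apply: lt_trans y1.
  have x0 : 0 \notin (power_tuple y nu : seq R).
    apply/negP => /tnthP[i]; rewrite tnth_mktuple => /eqP.
    by rewrite lt_eqF // exprz_gt0.
  have ux : uniq (power_tuple y nu).
    apply/tuple_uniqP => i j; rewrite !tnth_mktuple => /(ieexprIz y0).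
    by rewrite (gt_eqF y1) => /(_ isT)/expo_inj.
  have px : p ^+ N \notin (power_tuple y nu : seq R).
    apply/negP => /tnthP[i]; rewrite tnth_mktuple.
    have pN : 0 < p ^+ N by rewrite exprn_gt0.
    have pN' : 0 < p ^- N by rewrite invr_gt0.
    case: (ltgtP (expo nu i) 0) => [h|h|->].
    - move=> e; have : y <= p ^- N; last by apply/negP; rewrite -ltNge; lra.
      by rewrite e invr_expz -[leLHS]expr1z ler_eXz2l //; lia.
    - move=> e; have : y <= p ^+ N; last by apply/negP; rewrite -ltNge; lra.
      by rewrite e -[leLHS]expr1z ler_eXz2l //.
    rewrite expr0z -(expr0 p) => /expr_inj_pos N0; by move: i; rewrite N0 => -[].
  have ux' : uniq (rcons (power_tuple y nu) (p ^+ N)) by rewrite rcons_uniq px.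
  have := ec _ x0 ux'; rewrite ec' //.
  rewrite !(fsum_uniq_seq us) => [|k /out[-> _]|k /out[_ ->]]; rewrite ?mul0r //.
  move=> /eqP; rewrite eq_sym -subr_eq0 -sumrB => /eqP e.
  apply: (mulIf (invr_neq0 (vdm_neq0 ux))); rewrite mul0r -[RHS]e mulr_suml.
  apply: eq_bigr => k _; rewrite -mulrA -schurE /d -mulrBl.
  by rewrite -[LHS]mulrA; congr (_ * _); exact: mulrC.
apply/funext => mu; case: (boolP (mu \in s)) => [/d0/eqP|/out[-> ->]//].
rewrite mulf_eq0 invr_eq0 (gt_eqF (schur_geom_gt0 mu p0 p1)) orbF subr_eq0.
by move/eqP.
Qed.

End Links.

Lemma linkE (R : realType) (q : R) sigma N (lam : GT N.+1) :
  0 < q ^ sigma N.+1 -> q ^ sigma N.+1 != 1 ->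
  link q sigma lam = link_row (q ^ sigma N.+1) lam.
Proof.
move=> p0 p1; apply: xget_unique; first exact: link_row_is_link_row.
by move=> c hc; apply: (link_row_unique p0 p1 hc); exact: link_row_is_link_row.
Qed.

(** * The weight of a displaced coordinate *)

Lemma expo_gap N (lam : GT N) (i k : 'I_N) : (i < k)%N ->
  expo lam k + (k - i)%:Z <= expo lam i.
Proof.
move=> ik; rewrite /expo !(tnth_nth 0) -addrA; apply: lerD.
  by apply: GT_geP; rewrite (ltnW ik) ltn_ord.
rewrite -PoszD lez_nat; have := ltn_ord k; lia.
Qed.

(** The two kinds of steps are treated together: s = true is a step with variable
    q ^ N, whose weights favour the largest values lam_j of the coordinates, and
    s = false one with q ^- N, which favours the smallest values lam_(j+1). The
    favoured value is the frozen one. *)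
Definition frozen (s : bool) N (lam : GT N.+1) (j : nat) : int :=
  if s then lam`_j else lam`_j.+1.
(** The exponent of q that a unit displacement of coordinate j costs: its distance
    from the end of the signature at which a part gets lost. *)
Definition gap (s : bool) N (j : nat) : nat := if s then (N - j)%N else j.+1.

Definition freeze s N (lam : GT N.+1) (j : 'I_N) (nu : GT N) : GT N :=
  mkGT (fun i => if i == j then frozen s lam j else tnth nu i).

Lemma interlacesP N (lam : GT N.+1) (nu : GT N) (j : 'I_N) : interlaces lam nu ->
  lam`_j.+1 <= tnth nu j <= lam`_j.
Proof. by move=> /forallP. Qed.

Lemma frozen_bounds s N (lam : GT N.+1) (j : 'I_N) :
  lam`_j.+1 <= frozen s lam j <= lam`_j.
Proof.
have h : lam`_j.+1 <= lam`_j by apply: GT_geP; rewrite leqnSn ltnS ltn_ord.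
by rewrite /frozen; case: s; rewrite lexx h.
Qed.

Section Freeze.
Variables (s : bool) (N : nat) (lam : GT N.+1) (j : 'I_N) (nu : GT N).
Hypothesis lnu : interlaces lam nu.

Lemma tnth_freeze i :
  tnth (freeze s lam j nu) i = if i == j then frozen s lam j else tnth nu i.
Proof.
have bnd (c : 'I_N) : lam`_c.+1 <= (if c == j then frozen s lam j else tnth nu c) <= lam`_c.
  by case: eqP => [->|_]; [exact: frozen_bounds | exact: interlacesP].
rewrite /freeze mkGTE // => a b ab; have [->//|ne] := eqVneq a b.
have /andP[+ _] := bnd a; apply: le_trans; have /andP[_ +] := bnd b.
by move=> /le_trans; apply; apply: GT_geP; rewrite ltn_neqAle ne ab ltnW ?ltnS.
Qed.

Lemma interlaces_freeze : interlaces lam (freeze s lam j nu).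
Proof.
apply/forallP => i; rewrite tnth_freeze; case: eqP => [->|_].
  exact: frozen_bounds.
exact: interlacesP.
Qed.

Let m : nat := `|(tnth nu j - frozen s lam j)%R|%N.

Lemma dist_frozen : tnth nu j =
  if s then frozen s lam j - m%:Z else frozen s lam j + m%:Z.
Proof.
have := interlacesP j lnu; rewrite /m /frozen; case: s => /andP[h1 h2].
  by lia.
by lia.
Qed.

Lemma weight_freeze : weight (freeze s lam j nu) =
  if s then weight nu + m%:Z else weight nu - m%:Z.
Proof.
rewrite /weight (bigD1 j) //= [in RHS](bigD1 j) //= tnth_freeze eqxx.
rewrite (eq_bigr (fun i => tnth nu i)); last first.
  by move=> i ij; rewrite tnth_freeze (negPf ij).
by rewrite dist_frozen; case: s; lia.
Qed.

End Freeze.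

Section StepBound.
Variables (R : realType) (q : R).
Hypothesis hq : 0 < q < 1.

Let q0 : 0 < q. Proof. by case/andP: hq. Qed.
Let q1 : q < 1. Proof. by case/andP: hq. Qed.
Let u0 : 0 < 1 - q. Proof. by rewrite subr_gt0. Qed.

Lemma geom_sum_le n d : \sum_(i < n) q ^+ (d + i) <= q ^+ d / (1 - q).
Proof.
rewrite ler_pdivlMr //; under eq_bigr do rewrite exprD.
rewrite -mulr_sumr -mulrA ler_piMr ?exprn_ge0 ?(ltW q0) //.
have := subrX1 q n; rewrite -[1 - q]opprB mulrN mulrC => <-.
by rewrite opprB gerBl exprn_ge0 // ltW.
Qed.

(** An upper bound of 1 / ((1 - q) (1 - q^2) (1 - q^3) ...), uniform in the number
    of factors. *)
Definition step_const : R := expR ((1 - q)^-1 ^+ 2).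

Lemma prod_inv_le n : \prod_(i < n) (1 - q ^+ i.+1)^-1 <= step_const.
Proof.
apply: (@le_trans _ _ (\prod_(i < n) expR (q ^+ i.+1 / (1 - q)))).
  apply: ler_prod => i _.
  have qi : q ^+ i.+1 <= q by rewrite exprS ler_piMr ?exprn_ile1 ?ltW.
  have qi0 : 0 < q ^+ i.+1 by rewrite exprn_gt0.
  have d0 : 0 < 1 - q ^+ i.+1 by rewrite subr_gt0 (le_lt_trans qi).
  rewrite invr_ge0 (ltW d0) /=; apply: le_trans (expR_ge1Dx _).
  rewrite -[leLHS](mulr1) -lerBlDl.
  have -> : (1 - q ^+ i.+1)^-1 * 1 - 1 = q ^+ i.+1 / (1 - q ^+ i.+1).
    by rewrite mulr1 -{2}[q ^+ i.+1](subKr 1) mulrBl mul1r divff // gt_eqF.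
  by rewrite ler_wpM2l ?(ltW qi0) // lef_pV2 ?posrE //; lra.
rewrite -expR_sum ler_expR -mulr_suml expr2 ler_wpM2r ?invr_ge0 ?(ltW u0) //.
have := geom_sum_le n 1; rewrite expr1 => /le_trans; apply.
by rewrite ler_piMl ?invr_ge0 ?(ltW u0) ?ltW.
Qed.

Lemma prod_gap_le N m t : (t <= N)%N ->
  \prod_(i < N | (i < t)%N) (q ^- m / (1 - q ^+ (t - i))) <= q ^- (m * t) * step_const.
Proof.
move=> tN; rewrite -(big_ord_widen N (fun i => q ^- m / (1 - q ^+ (t - i))) tN).
rewrite big_split prodr_const card_ord /= -exprVn -exprM exprVn.
apply: ler_wpM2l; first by rewrite invr_ge0 exprn_ge0 // ltW.
rewrite (reindex_inj rev_ord_inj) /= (le_trans _ (prod_inv_le t)) //.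
rewrite le_eqVlt; apply/orP; left; apply/eqP; apply: eq_bigr => i _.
by rewrite subKn.
Qed.

(** The factor by which a difference in a Vandermonde product shrinks when its larger
    entry y is replaced by y' = q ^ m * y, a geometric gap to the smaller entry x
    being left. *)
Lemma ratio_le (x y y' : R) m d : 0 < x -> 0 < y -> (0 < d)%N -> y' = q ^+ m * y ->
  x <= q ^+ d * y' -> (y - x) / (y' - x) <= q ^- m / (1 - q ^+ d).
Proof.
move=> x0 y0 d0 y'E xle.
have y'0 : 0 < y' by rewrite y'E mulr_gt0 // exprn_gt0.
have qd : q ^+ d < 1 by rewrite exprn_ilt1 ?ltW // -lt0n.
have e0 : 0 < y' * (1 - q ^+ d) by rewrite mulr_gt0 // subr_gt0.
have le1 : y' * (1 - q ^+ d) <= y' - x by rewrite mulrBr mulr1 mulrC; lra.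
have yE : y = q ^- m * y' by rewrite y'E mulKf // expf_neq0 // gt_eqF.
rewrite ler_pdivrMr; last by apply: lt_le_trans le1.
apply: (@le_trans _ _ y); first by rewrite gerBl ltW.
rewrite {1}yE -mulrA ler_wpM2l ?invr_ge0 ?exprn_ge0 ?(ltW q0) //.
by rewrite mulrC ler_pdivlMr ?subr_gt0.
Qed.

Lemma ratio_le1 (x y y' : R) : 0 < y' -> y' <= y -> y < x -> (x - y) / (x - y') <= 1.
Proof.
move=> y'0 y'y yx; rewrite ler_pdivrMr ?mul1r; last by rewrite subr_gt0; lra.
by rewrite lerB.
Qed.

Definition base (s : bool) : R := if s then q else q^-1.

Section FreezeWeight.
Variables (s : bool) (N : nat) (lam : GT N.+1) (j : 'I_N) (nu : GT N).
Hypothesis lnu : interlaces lam nu.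

Let m : nat := `|(tnth nu j - frozen s lam j)%R|%N.
Let nu' := freeze s lam j nu.
Let z (la : GT N) i := base s ^ expo la i.

Lemma base_gt0 : 0 < base s.
Proof. by rewrite /base; case: s; rewrite ?invr_gt0. Qed.

Lemma base_neq1 : base s != 1.
Proof. by rewrite /base; case: s; rewrite ?invr_eq1 lt_eqF. Qed.

Let zE la i : z la i = q ^ (if s then expo la i else - expo la i).
Proof. by rewrite /z /base; case: s => //; rewrite exprz_inv. Qed.

Let z_gt0 la i : 0 < z la i.
Proof. by rewrite exprz_gt0 // base_gt0. Qed.

Let z_other i : i != j -> z nu' i = z nu i.
Proof. by move=> ij; rewrite /z /expo tnth_freeze // (negPf ij). Qed.

Let z_frozen : z nu' j = q ^+ m * z nu j.
Proof.
rewrite !zE -[q ^+ m]/(q ^ m%:Z) -expfzDr ?gt_eqF //; congr (_ ^ _).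
by rewrite /expo tnth_freeze // eqxx (dist_frozen s j lnu) -/m; case: (s); lia.
Qed.

Let z_lt (la : GT N) (i k : 'I_N) : (i < k)%N ->
  if s then z la i < z la k else z la k < z la i.
Proof.
move=> ik; have := expo_lt la ik; rewrite !zE.
by case: s => h; rewrite ltr_decrz // ltrN2.
Qed.

Let z_gap (la : GT N) (i k : 'I_N) : (i < k)%N ->
  if s then z la i <= q ^+ (k - i) * z la k else z la k <= q ^+ (k - i) * z la i.
Proof.
move=> ik; have := expo_gap la ik; rewrite !zE -[q ^+ (k - i)]/(q ^ (k - i)%:Z).
rewrite -!expfzDr ?gt_eqF //.
by case: s => h; rewrite leNgt ltr_decrz // -leNgt; lia.
Qed.

Let frozen_le : z nu' j <= z nu j.
Proof.
by rewrite z_frozen ler_piMl ?(ltW (z_gt0 _ _)) // exprn_ile1 ?ltW.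
Qed.

(* Freezing j multiplies the entry z j of the Vandermonde product by q ^ m. The
   differences with larger entries then grow, those with smaller entries shrink
   at most by this factor. *)
Let factor (i k : 'I_N) : R :=
  if (if s then k else i) == j then q ^- m / (1 - q ^+ (k - i)) else 1.

Let pair_le (i k : 'I_N) : (i < k)%N ->
  (z nu k - z nu i) / (z nu' k - z nu' i) <= factor i k.
Proof.
move=> ik; have dik : (0 < k - i)%N by rewrite subn_gt0.
have ki : k != i by rewrite -val_eqE gtn_eqF.
have fz c : c = j -> z nu' c = q ^+ m * z nu c by move=> ->; exact: z_frozen.
have fle c : c = j -> z nu' c <= z nu c by move=> ->; exact: frozen_le.
rewrite /factor; move: (fz i) (fz k) (fle i) (fle k) (@z_other i) (@z_other k).
move: (z_lt nu ik) (z_gap nu' ik).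
move: (z_gt0 nu i) (z_gt0 nu k) (z_gt0 nu' i) (z_gt0 nu' k).
move: (z nu i) (z nu k) (z nu' i) (z nu' k) => a b a' b'.
case: (s) => a0 b0 a'0 b'0 lt gp fi fk li lk oi ok.
  case: eqP => [e|/eqP/ok eb].
    have ij : i != j by rewrite -e eq_sym.
    by rewrite (oi ij) in gp *; apply: ratio_le => //; exact: fk.
  have [e|/oi ea] := eqVneq i j; first by rewrite eb ratio_le1 // li.
  by rewrite eb ea divff // gt_eqF // subr_gt0.
rewrite -[_ / _]mulrNN -invrN !opprB.
case: eqP => [e|/eqP/oi ea].
  have kj : k != j by rewrite -e.
  by rewrite (ok kj) in gp *; apply: ratio_le => //; exact: fi.
have [e|/ok eb] := eqVneq k j; first by rewrite ea ratio_le1 // lk.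
by rewrite eb ea divff // gt_eqF // subr_gt0.
Qed.

(* The number of entries smaller than z j. *)
Let moved : nat := if s then (j : nat) else (N - j.+1)%N.

Let prod_factor :
  \prod_(i < N) \prod_(k < N | (i < k)%N) factor i k <= q ^- (m * moved) * step_const.
Proof.
have mN : (moved <= N)%N by rewrite /moved; case: (s); rewrite ?leq_subr // ltnW.
apply: le_trans (prod_gap_le m mN); rewrite /moved /factor; case: (s).
  rewrite [leRHS]big_mkcond; apply: ler_prod => i _; apply/andP; split.
    apply: prodr_ge0 => k ik; case: eqP => // _.
    rewrite divr_ge0 ?invr_ge0 ?exprn_ge0 ?(ltW q0) // subr_ge0.
    by rewrite exprn_ile1 ?ltW.
  rewrite -big_mkcondr; case: ifP => ij.
    rewrite (big_pred1 j) // => k; rewrite andbC /=.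
    by case: eqP => [->|//]; rewrite ij.
  by rewrite big_pred0 // => k; case: eqP => [->|]; rewrite ?ij ?andbF.
rewrite (bigD1 j) //= [X in _ * X]big1 ?mulr1; last first.
  by move=> i /negPf ij; apply: big1 => k _; rewrite ij.
rewrite (reindex_inj rev_ord_inj) /= eqxx.
rewrite le_eqVlt; apply/orP; left; apply/eqP; apply: eq_big => i.
  by have := ltn_ord i; have := ltn_ord j; lia.
by move=> ij; congr (_ / (1 - q ^+ _)); have := ltn_ord i; lia.
Qed.

Let schur_le : schur nu (geom_tuple (base s) N) <=
  q ^- (m * moved) * step_const * schur nu' (geom_tuple (base s) N).
Proof.
have dpos (la : GT N) (i k : 'I_N) : (i < k)%N ->
    0 < (z la k - z la i) / (base s ^+ i - base s ^+ k).
  move=> ik; have ik' : i%:Z < k%:Z by rewrite ltz_nat.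
  have := exprz_decr_sign base_gt0 base_neq1 (expo_lt la ik) ik'.
  by rewrite -[X in 0 < X]mulrNN -invrN !opprB.
apply: (@le_trans _ _ (\prod_(i < N) \prod_(k < N | (i < k)%N) factor i k *
    schur nu' (geom_tuple (base s) N))); last first.
  rewrite ler_wpM2r ?prod_factor // ltW // schur_geom_gt0 ?base_gt0 //.
  exact: base_neq1.
rewrite !schur_geom -big_split /=; apply: ler_prod => i _; apply/andP; split.
  by apply: prodr_ge0 => k ik; apply/ltW/dpos.
rewrite -big_split /=; apply: ler_prod => k ik; rewrite ltW ?dpos //=.
apply: le_trans (ler_wpM2r (ltW (dpos nu' i k ik)) (pair_le ik)).
rewrite mulrA divfK //; have := dpos nu' i k ik.
by move=> /gt_eqF/negbT; rewrite mulf_eq0 negb_or => /andP[].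
Qed.

(** A displacement by m multiplies the power of q ^ N in the weight by q ^ (N * m),
    while each of the smaller entries of the Vandermonde product gives back at
    most q ^- m, up to a bounded constant. *)
Lemma link_row_freeze :
  link_row (base s) lam nu <=
  step_const * q ^+ (gap s N j * m) * link_row (base s) lam nu'.
Proof.
rewrite /link_row lnu interlaces_freeze //.
rewrite [leRHS]mulrA ler_wpM2r ?invr_ge0
  ?(ltW (schur_geom_gt0 _ base_gt0 base_neq1)) //.
have -> : (base s ^+ N) ^ (weight lam - weight nu) =
    q ^+ (N * m) * (base s ^+ N) ^ (weight lam - weight nu').
  rewrite -[base s ^+ N]/(base s ^ N%:Z) !exprz_exp /base /nu'.
  rewrite weight_freeze // -/m.
  rewrite -[q ^+ (N * m)]/(q ^ (N * m)%:Z).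
  case: (s); rewrite ?exprz_inv -expfzDr ?gt_eqF //; congr (_ ^ _); lia.
have -> : (N * m = m * moved + gap s N j * m)%N.
  rewrite [(m * _)%N]mulnC -mulnDl; congr (_ * _)%N; rewrite /moved /gap.
  by case: (s); have := ltn_ord j; lia.
rewrite exprD -!mulrA; have := schur_le.
set S := schur nu _; set S' := schur nu' _; set Z := (_ ^+ N) ^ _.
have Z0 : 0 <= Z by rewrite exprz_ge0 // exprn_ge0 // ltW // base_gt0.
move=> h; rewrite mulrCA [leRHS]mulrCA ler_wpM2l ?exprn_ge0 ?(ltW q0) //.
rewrite mulrCA [leRHS]mulrCA ler_wpM2l //.
apply: le_trans (ler_wpM2l (exprn_ge0 _ (ltW q0)) h) _.
by rewrite !mulrA mulfV ?mul1r // expf_neq0 // gt_eqF.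
Qed.

End FreezeWeight.

End StepBound.

(** * Coordinates that stay in place in one step *)

Lemma ler_sum_inj (R : numDomainType) (T : eqType) (r : seq T) (P Q : pred T)
    (f : T -> T) (F G : T -> R) : uniq r ->
  {in [pred x in r | P x] &, injective f} ->
  {in r, forall x, P x -> (f x \in r) && Q (f x)} ->
  {in r, forall x, P x -> F x <= G (f x)} -> (forall x, 0 <= G x) ->
  \sum_(x <- r | P x) F x <= \sum_(x <- r | Q x) G x.
Proof.
move=> ur finj fP FG G0.
apply: (@le_trans _ _ (\sum_(x <- r | P x) G (f x))).
  rewrite big_seq_cond [leRHS]big_seq_cond.
  by apply: ler_sum => x /andP[xr Px]; exact: FG.
rewrite -big_filter -[leRHS]big_filter -(big_map f xpredT G).
set s1 := [seq f x | x <- r & P x]; set s2 := [seq x <- r | Q x].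
have u1 : uniq s1.
  rewrite map_inj_in_uniq ?filter_uniq // => x y.
  by rewrite !mem_filter ![_ && (_ \in r)]andbC; exact: finj.
have sub : {subset s1 <= s2}.
  move=> y /mapP[x]; rewrite mem_filter => /andP[Px xr] ->.
  by rewrite mem_filter andbC; exact: fP.
rewrite [leRHS](bigID (mem s1) predT) /= -[leLHS]addr0 lerD ?sumr_ge0 //.
rewrite -[leRHS]big_filter le_eqVlt; apply/orP; left; apply/eqP; apply: perm_big.
apply: uniq_perm => //; first by rewrite !filter_uniq.
by move=> x; rewrite mem_filter; case: (boolP (x \in s1)) => // /sub ->.
Qed.

Section Peel.
Variables (R : realType) (q : R).
Hypothesis hq : 0 < q < 1.
Variables (s : bool) (N : nat) (lam : GT N.+1).

Let q0 : 0 < q. Proof. by case/andP: hq. Qed.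
Let q1 : q < 1. Proof. by case/andP: hq. Qed.

Let w := link_row (base q s) lam.
Let w_ge0 nu : 0 <= w nu.
Proof. exact: link_row_ge0 (base_gt0 hq s) (base_neq1 hq s) _ _ _. Qed.

Let frozen_on (J : seq 'I_N) (nu : GT N) := all (fun j => tnth nu j == frozen s lam j) J.

Let C := step_const q.
Let C_ge0 : 0 <= C. Proof. exact: expR_ge0. Qed.
Let K (j : 'I_N) := C * (q ^+ gap s N j / (1 - q)).

Let dist (j : 'I_N) (nu : GT N) : nat := `|(tnth nu j - frozen s lam j)%R|%N.

(* For each m, freezing j is injective on the signatures with displacement m.+1;
   the weights lost for the different m form a geometric series. *)
Let moved_sum_le J (j : 'I_N) : j \notin J ->
  \sum_(nu <- below lam | frozen_on J nu && (tnth nu j != frozen s lam j)) w nu <=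
  K j * \sum_(nu <- below lam | frozen_on (j :: J) nu) w nu.
Proof.
move=> jJ; set Z := \sum_(nu <- _ | frozen_on (j :: J) _) _.
have Z0 : 0 <= Z by apply: sumr_ge0.
pose p nu : 'I_(spread lam).+1 := inord (dist j nu).-1.
rewrite (partition_big p predT) //=.
apply: (@le_trans _ _ (\sum_(m < (spread lam).+1) C * q ^+ (gap s N j + m) * Z)).
  apply: ler_sum => m _.
  rewrite big_seq_cond (eq_bigl (fun nu => (nu \in below lam) &&
    (frozen_on J nu && (dist j nu == m.+1)))); last first.
    move=> nu; case: (boolP (nu \in _)) => //=; rewrite mem_below => lnu.
    case: (frozen_on J nu) => //=.
    have lt : ((dist j nu).-1 < (spread lam).+1)%N.
      have /andP[h1 h2] := interlacesP j lnu; have /andP[h3 h4] := frozen_bounds s lam j.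
      have h5 : lam`_j <= lam`_0 by apply: GT_geP; rewrite /= ltnS ltnW.
      have h6 : lam`_N <= lam`_j.+1 by apply: GT_geP; rewrite ltn_ord ltnSn.
      by rewrite /spread /dist; lia.
    rewrite -val_eqE /= inordK // -subr_eq0 -absz_eq0 -/(dist j nu).
    by case: (dist j nu) => [|d]; rewrite ?andbF.
  rewrite -big_seq_cond mulr_sumr.
  apply: (@ler_sum_inj _ _ _ _ _ (freeze s lam j)); first exact: below_uniq.
  - move=> nu1 nu2; rewrite !inE !mem_below.
    move=> /and3P[l1 _ /eqP d1] /and3P[l2 _ /eqP d2] e.
    apply: GT_ext => i; have := congr1 (fun nu : GT N => tnth nu i) e.
    rewrite !tnth_freeze //; case: eqP => // -> _.
    by rewrite (dist_frozen s j l1) (dist_frozen s j l2) -!/(dist _ _) d1 d2.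
  - move=> nu; rewrite mem_below => lnu /andP[/allP fr _].
    rewrite mem_below interlaces_freeze //= tnth_freeze // eqxx eqxx /=.
    apply/allP => i iJ; rewrite tnth_freeze //.
    by have [e|_] := eqVneq i j; [rewrite -e iJ in jJ | exact: fr].
  - move=> nu; rewrite mem_below => lnu /andP[_ /eqP d].
    apply: le_trans (link_row_freeze hq s j lnu) _.
    rewrite -/(dist j nu) d ler_wpM2r // ler_wpM2l //.
    apply: ler_wiXn2l; rewrite ?(ltW q0) ?(ltW q1) //.
    by rewrite mulnS leq_add2l leq_pmull // /gap; case: (s); rewrite ?subn_gt0.
  - by move=> nu; rewrite mulr_ge0 // mulr_ge0 // exprn_ge0 // ltW.
rewrite -mulr_suml ler_wpM2r // -mulr_sumr /K ler_wpM2l //.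
exact: geom_sum_le.
Qed.

(* Freezing the coordinates of J one after the other, starting from total mass 1. *)
Let peel J : uniq J ->
  1 <= \prod_(j <- J) (1 + K j) * \sum_(nu <- below lam | frozen_on J nu) w nu.
Proof.
have K_ge0 j : 0 <= K j.
  by rewrite mulr_ge0 // divr_ge0 ?exprn_ge0 ?subr_ge0 ?ltW.
elim: J => [_|j J IH /= /andP[jJ uJ]].
  by rewrite big_nil mul1r sum_link_row // ?base_gt0 ?base_neq1.
apply: le_trans (IH uJ) _; rewrite big_cons mulrAC [leRHS]mulrC.
rewrite ler_wpM2l //; first by apply: prodr_ge0 => i _; rewrite addr_ge0.
rewrite (bigID (fun nu : GT N => tnth nu j == frozen s lam j)) /= mulrDl mul1r lerD //.
  by rewrite le_eqVlt; apply/orP; left; apply/eqP/eq_bigl => nu; rewrite andbC.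
exact: moved_sum_le.
Qed.

Lemma sum_gap_le g0 :
  \sum_(j < N | (g0 <= gap s N j)%N) q ^+ gap s N j <= q ^+ g0 / (1 - q).
Proof.
have e : \sum_(j < N | (g0 <= gap s N j)%N) q ^+ gap s N j =
    \sum_(j < N | (g0 <= j.+1)%N) q ^+ j.+1.
  rewrite /gap; case: (s) => //; rewrite (reindex_inj rev_ord_inj) /=.
  by apply: eq_big => [j|j _]; rewrite subKn.
rewrite e; apply: (@le_trans _ _ (\sum_(j < N.+1 | (g0 <= j)%N) q ^+ j)).
  rewrite big_mkcond [leRHS]big_mkcond big_ord_recl /= lerDr.
  by case: ifP => // _; rewrite exprn_ge0 // ltW.
rewrite -(big_geq_mkord g0 N.+1 xpredT (fun j => q ^+ j)).
rewrite -{1}[g0]add0n big_addn big_mkord.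
by under eq_bigr do rewrite addnC; exact: geom_sum_le.
Qed.

Definition step_rate : R := C / (1 - q) ^+ 2.

(** The coordinates at distance at least g0 from the edge all stay in place with a
    probability that is positive uniformly in lam and N, and tends to 1 as g0 grows:
    the bounds 1 + K j multiply up, and the K j are summable. *)
Theorem frozen_prob g0 : expR (- (step_rate * q ^+ g0)) <=
  \sum_(nu <- below lam | [forall j : 'I_N, (g0 <= gap s N j)%N ==>
                            (tnth nu j == frozen s lam j)]) w nu.
Proof.
pose J := enum [pred j : 'I_N | (g0 <= gap s N j)%N].
have := peel (enum_uniq _ : uniq J).
rewrite (eq_bigl (fun nu : GT N => [forall j : 'I_N, (g0 <= gap s N j)%N ==>
                            (tnth nu j == frozen s lam j)])); last first.
  move=> nu; apply/allP/forallP => h j.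
    by apply/implyP => gj; apply: h; rewrite mem_enum inE.
  by rewrite mem_enum inE; exact/implyP.
set Z := \sum_(nu <- _ | _) _ => h.
have Z0 : 0 <= Z by apply: sumr_ge0.
rewrite expRN -[leLHS]mul1r ler_pdivrMr ?expR_gt0 // mulrC.
apply: le_trans h _; rewrite ler_wpM2r //.
apply: (@le_trans _ _ (\prod_(j <- J) expR (K j))).
  apply: ler_prod => j _; rewrite expR_ge1Dx andbT addr_ge0 //.
  by rewrite mulr_ge0 // divr_ge0 ?exprn_ge0 ?subr_ge0 ?ltW.
rewrite -expR_sum ler_expR /J big_enum /= -mulr_sumr /step_rate.
rewrite -mulrA ler_wpM2l //.
rewrite -mulr_suml [leRHS]mulrC expr2 invfM mulrA.
rewrite ler_wpM2r ?invr_ge0 ?subr_ge0 ?(ltW q1) //.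
exact: sum_gap_le.
Qed.

End Peel.

(** * Labels *)

(** The levels are joined into one type of states, so that iterating a step needs no
    casts between levels. *)
Definition state := {N : nat & GT N}.

Definition dir (sigma : nat -> int) (n : nat) : bool := sigma n == 1.

Section Labels.
Variable sigma : nat -> int.
Hypothesis hsigma : forall i : nat, (0 < i)%N -> sigma i = 1 \/ sigma i = -1.
Notation dir := (dir sigma).
Notation b := (b sigma).
Definition pluses (n : nat) : nat := (n - b n)%N.
Notation a := pluses.

Lemma bS n : b n.+1 = (b n + ~~ dir n.+1)%N.
Proof.
rewrite /Defs.b big_nat_recr //=; congr (_ + _)%N; congr nat_of_bool; rewrite /dir.
by have [] := @hsigma n.+1 isT => ->.
Qed.

Lemma b_le n : (b n <= n)%N.
Proof.
elim: n => [|n IH]; first by rewrite /Defs.b big_geq.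
by rewrite bS; case: dir; rewrite /= ?addn0 ?addn1 // ltnW.
Qed.

Lemma aS n : a n.+1 = (a n + dir n.+1)%N.
Proof. by rewrite /pluses bS; have := b_le n; case: dir => /=; lia. Qed.

Lemma abE n : (a n + b n = n)%N.
Proof. by rewrite /pluses subnK // b_le. Qed.

Lemma leq_b m n : (m <= n)%N -> (b m <= b n)%N.
Proof.
move=> mn; rewrite -(subnK mn); elim: (n - m)%N => // d IH.
by rewrite addSn bS (leq_trans IH) // leq_addr.
Qed.

Lemma leq_a m n : (m <= n)%N -> (a m <= a n)%N.
Proof.
move=> mn; rewrite -(subnK mn); elim: (n - m)%N => // d IH.
by rewrite addSn aS (leq_trans IH) // leq_addr.
Qed.

(** Counting parts from the index b N + 1 makes the frozen value of a part, in a step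
    of either kind, the part of the higher signature with the same label. The
    labels at level n are those in (- a n, b n]. *)
Definition lab (x : state) (i : int) : int :=
  part (tagged x) ((b (tag x))%:Z + 1 - i).

Lemma labE n (lam : GT n) (i : int) (k : nat) : (b n)%:Z - i = k%:Z ->
  lab (Tagged GT lam) i = lam`_k.
Proof.
move=> e; rewrite /lab /part /=.
by have -> : (b n)%:Z + 1 - i = k.+1 by lia.
Qed.

Definition agree (u v : nat) (t : int -> int) (x : state) : Prop :=
  forall i : int, - u%:Z < i -> i <= v%:Z -> lab x i = t i.

Lemma agree_sub u v u' v' t x : (u <= u')%N -> (v <= v')%N ->
  agree u' v' t x -> agree u v t x.
Proof. by move=> uu vv h i ui iv; apply: h; lia. Qed.

(** The window (- a n, b n] contains all labels of level n. *)
Lemma agree_full n t x y : tag x = n -> tag y = n ->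
  agree (a n) (b n) t x -> agree (a n) (b n) t y -> x = y.
Proof.
case: x => N lam /= e1; subst N; case: y => N mu /= e2; subst N.
move=> hx hy; congr (existT _ _ _); apply: GT_ext => j; rewrite !(tnth_nth 0).
have e : (b n)%:Z - ((b n)%:Z - j%:Z) = j by lia.
have := abE n; have := ltn_ord j => jn ab.
have := hx ((b n)%:Z - j%:Z); rewrite (labE lam e) => -> //; try lia.
by have := hy ((b n)%:Z - j%:Z); rewrite (labE mu e) => -> //; lia.
Qed.

End Labels.

(** * The chain of links acting on functions *)

Section Chain.
Variables (R : realType) (q : R) (sigma : nat -> int).
Hypothesis hq : 0 < q < 1.
Hypothesis hsigma : forall i : nat, (0 < i)%N -> sigma i = 1 \/ sigma i = -1.

Let q0 : 0 < q. Proof. by case/andP: hq. Qed.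
Let q1 : q < 1. Proof. by case/andP: hq. Qed.

(** The matrices of links are used through expectations: expect f x averages f over
    the states one level below x. Levels have countably many states, but every
    expectation is a finite sum. *)
Definition expect (f : state -> R) (x : state) : R :=
  let: existT N lam := x in
  match N return GT N -> R with
  | 0 => fun lam => f (Tagged GT lam)
  | N'.+1 => fun lam =>
      \sum_(nu <- below lam) link q sigma lam nu * f (Tagged GT nu)
  end lam.

Definition expects (m : nat) : (state -> R) -> state -> R := iter m expect.

Notation dir := (dir sigma).
Notation a := (pluses sigma).
Notation b := (b sigma).
Notation agree := (agree sigma).
Notation lab := (lab sigma).

Let base_dir n : (0 < n)%N -> q ^ sigma n = base q (dir n).
Proof. by move=> /hsigma[]h; rewrite /dir /base h. Qed.

Lemma link_base N (lam : GT N.+1) : link q sigma lam = link_row (base q (dir N.+1)) lam.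
Proof. by rewrite linkE base_dir // ?base_gt0 ?base_neq1. Qed.

Lemma link_ge0 N (lam : GT N.+1) nu : 0 <= link q sigma lam nu.
Proof. by rewrite link_base link_row_ge0 ?base_gt0 ?base_neq1. Qed.

Lemma sum_link N (lam : GT N.+1) : \sum_(nu <- below lam) link q sigma lam nu = 1.
Proof. by rewrite link_base sum_link_row ?base_gt0 ?base_neq1. Qed.

Lemma link_out N (lam : GT N.+1) nu : nu \notin below lam -> link q sigma lam nu = 0.
Proof. by rewrite mem_below link_base /link_row => /negPf ->. Qed.

Lemma expect_linear c f g :
  expect (fun y => c * f y + g y) = fun x => c * expect f x + expect g x.
Proof.
apply/funext => -[[|N] lam] //=; rewrite mulr_sumr -big_split /=.
by apply: eq_bigr => nu _; rewrite mulrDr mulrCA.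
Qed.

Lemma expect_cst c : expect (fun=> c) = fun=> c.
Proof. by apply/funext => -[[|N] lam] //=; rewrite -mulr_suml sum_link mul1r. Qed.

Lemma expect_le n f g : (forall y, tag y = n -> f y <= g y) ->
  forall x, tag x = n.+1 -> expect f x <= expect g x.
Proof.
move=> fg [[|N] lam] //= [e]; apply: ler_sum => nu _.
by rewrite ler_wpM2l ?link_ge0 // fg.
Qed.

Lemma expects_linear m c f g :
  expects m (fun y => c * f y + g y) = fun x => c * expects m f x + expects m g x.
Proof.
by elim: m => [//|m IH]; rewrite /expects !iterS -!/(expects _ _) IH expect_linear.
Qed.

Lemma expects_cst m c : expects m (fun=> c) = fun=> c.
Proof.
by elim: m => [//|m IH]; rewrite /expects iterS -/(expects _ _) IH expect_cst.
Qed.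

Lemma expects_le n m f g : (forall y, tag y = n -> f y <= g y) ->
  forall x, tag x = (m + n)%N -> expects m f x <= expects m g x.
Proof.
move=> fg; elim: m => [|m IH] x; first exact: fg.
by move=> xn; apply: (@expect_le (m + n)).
Qed.

Lemma expectsD m f g : expects m (fun y => f y + g y) =
  fun x => expects m f x + expects m g x.
Proof.
have := expects_linear m 1 f g; under eq_fun do rewrite mul1r.
by move=> ->; apply/funext => x; rewrite mul1r.
Qed.

Lemma expectsZ m c f : expects m (fun y => c * f y) = fun x => c * expects m f x.
Proof.
have := expects_linear m c f (fun=> 0); under eq_fun do rewrite addr0.
by move=> ->; apply/funext => x; rewrite expects_cst addr0.
Qed.

Lemma expects_comp m1 m2 f x :
  expects (m1 + m2) f x = expects m1 (expects m2 f) x.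
Proof. by rewrite /expects iterD. Qed.

Lemma expects_bounds n m f lo hi : (forall y, tag y = n -> lo <= f y <= hi) ->
  forall x, tag x = (m + n)%N -> lo <= expects m f x <= hi.
Proof.
move=> h x xn; rewrite -[lo](congr1 (fun f => f x) (expects_cst m lo)).
rewrite -[hi](congr1 (fun f => f x) (expects_cst m hi)).
by apply/andP; split; apply: (@expects_le n) => // y /h /andP[].
Qed.

Definition char_of (A : state -> Prop) (y : state) : R := (`[< A y >])%:R.

Lemma char_of_bounds A y : 0 <= char_of A y <= 1.
Proof. by rewrite /char_of; case: `[< _ >]; rewrite ?lexx ?ler01. Qed.

Lemma links_expects k m (lam : GT (m + k)) (mu : GT k) :
  links q sigma lam mu = expects m (char_of (eq^~ (Tagged GT mu))) (Tagged GT lam).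
Proof.
elim: m lam => [|m IH] lam /=.
  rewrite /char_of; congr (nat_of_bool _)%:R.
  by apply/eqP/asboolP => [->//|/eqP]; rewrite eq_Tagged => /eqP.
rewrite (fsum_uniq_seq (below_uniq lam)) => [|nu /link_out ->]; last by rewrite mul0r.
by apply: eq_bigr => nu _; rewrite IH.
Qed.

(** The window in which x agrees with t keeps a distance from the edge that loses a
    part in the step, so its labels survive unchanged when all coordinates at
    least that far from the edge are frozen. *)
Lemma expect_agree n u v t x : tag x = n.+1 -> (u <= a n)%N -> (v <= b n)%N ->
  agree u v t x ->
  expR (- (step_rate q * q ^+ (if dir n.+1 then a n - u else b n - v)%N.+1)) <=
  expect (char_of (agree u v t)) x.
Proof.
case: x => N lam /= e; subst N => ua vb h.
apply: le_trans (frozen_prob hq (dir n.+1) lam _) _.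
rewrite -link_base big_mkcond /= big_seq [leRHS]big_seq; apply: ler_sum => nu.
rewrite mem_below => lnu; case: forallP => [fr|_]; last first.
  have /andP[c0 _] := char_of_bounds (agree u v t) (Tagged GT nu).
  by rewrite mulr_ge0 ?link_ge0.
suff /asboolP : agree u v t (Tagged GT nu).
  by rewrite /char_of => ->; rewrite mulr1.
move=> i ui iv; rewrite -h //.
have := abE hsigma n => ab.
have [k ke] : exists k : nat, (b n)%:Z - i = k.
  by exists `|((b n)%:Z - i)%R|%N; lia.
have kn : (k < n)%N by lia.
have := fr (Ordinal kn); rewrite (labE _ ke).
rewrite (tnth_nth 0) /= /gap /frozen; case: (boolP (dir n.+1)) => d /=.
  move=> /implyP hk; rewrite (eqP (hk _)); last by lia.
  by symmetry; apply: labE; rewrite (bS hsigma) d addn0.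
move=> /implyP hk; rewrite (eqP (hk _)); last by lia.
by symmetry; apply: labE; rewrite (bS hsigma) d; lia.
Qed.

End Chain.

(** * Labels that stay in place along the chain *)

Section Coupling.
Variables (R : realType) (q : R) (sigma : nat -> int).
Hypothesis hq : 0 < q < 1.
Hypothesis hsigma : forall i : nat, (0 < i)%N -> sigma i = 1 \/ sigma i = -1.
Hypothesis hplus : infinite_set [set i : nat | (0 < i)%N /\ sigma i = 1].
Hypothesis hminus : infinite_set [set i : nat | (0 < i)%N /\ sigma i = -1].

Let q0 : 0 < q. Proof. by case/andP: hq. Qed.
Let q1 : q < 1. Proof. by case/andP: hq. Qed.
Let u0 : 0 < 1 - q. Proof. by rewrite subr_gt0. Qed.

Notation E := (expects q sigma).
Notation a := (pluses sigma).
Notation b := (Defs.b sigma).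
Notation agree := (agree sigma).
Notation dir := (dir sigma).

(** Each step down from level n.+1 to n decreases a or b by one, so the losses
    step_rate * q ^ distance of all the steps above level n sum to a geometric
    series in the distances of the window from the two edges of level n. *)
Definition stay_rate : R := step_rate q / (1 - q).

Lemma stay_rate_ge0 : 0 <= stay_rate.
Proof.
rewrite /stay_rate /step_rate divr_ge0 ?(ltW u0) // divr_ge0 ?exprn_ge0 ?(ltW u0) //.
exact: expR_ge0.
Qed.

Definition stay (n u v : nat) : R :=
  expR (- (stay_rate * (q ^+ (a n - u)%N.+1 + q ^+ (b n - v)%N.+1))).

Lemma stay_step n u v : (u <= a n)%N -> (v <= b n)%N ->
  expR (- (step_rate q * q ^+ (if dir n.+1 then a n - u else b n - v)%N.+1)) *
    stay n.+1 u v = stay n u v.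
Proof.
move=> ua vb; rewrite /stay -expRD (aS hsigma) (bS hsigma).
have -> : step_rate q = stay_rate * (1 - q) by rewrite divfK // gt_eqF.
congr expR; case: ifP => d /=.
  by rewrite addn0 addn1 (subSn ua) [q ^+ (_ - u).+2]exprS; lra.
by rewrite addn0 addn1 (subSn vb) [q ^+ (_ - v).+2]exprS; lra.
Qed.

Lemma stay_le1 n u v : stay n u v <= 1.
Proof.
rewrite /stay -expR0 ler_expR oppr_le0 mulr_ge0 ?stay_rate_ge0 //.
by rewrite addr_ge0 // exprn_ge0 // ltW.
Qed.

(** Any number of steps: the bound does not depend on m, nor on x outside of the
    window. *)
Lemma expects_agree n m u v t x : tag x = (m + n)%N -> (u <= a n)%N -> (v <= b n)%N ->
  agree u v t x -> stay n u v <= E m (char_of R (agree u v t)) x.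
Proof.
elim: m n x => [|m IH] n x xn ua vb h.
  by rewrite /= /char_of; case: asboolP => // _; exact: stay_le1.
rewrite /expects iterSr -!/(expects _ _ _).
pose c := expR (- (step_rate q * q ^+ (if dir n.+1 then a n - u else b n - v)%N.+1)).
apply: (@le_trans _ _ (E m (fun y => c * char_of R (agree u v t) y) x)); last first.
  apply: (expects_le hq hsigma (n := n.+1)); last by rewrite xn addnS.
  move=> y yn; rewrite {1}/char_of; case: asboolP => hy.
    by rewrite mulr1; exact: (expect_agree hq hsigma).
  rewrite mulr0 -(congr1 (fun f => f y) (expect_cst hq hsigma 0)).
  apply: (expect_le hq hsigma (n := n)) yn => z _.
  by case/andP: (char_of_bounds R (agree u v t) z).
rewrite (expectsZ hq hsigma) -(stay_step ua vb) ler_wpM2l ?expR_ge0 //.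
apply: IH; rewrite ?xn ?addnS //.
  by rewrite (leq_trans ua) // (leq_a hsigma).
by rewrite (leq_trans vb) // (leq_b hsigma).
Qed.

Lemma unbounded_b M : exists n, (M <= b n)%N.
Proof.
elim: M => [|M [n hn]]; first by exists 0%N.
have [i [i0 si] ni] : exists2 i, (0 < i)%N /\ sigma i = -1 & (n < i)%N.
  apply: contrapT => h; apply: hminus.
  apply: (@sub_finite_set _ _ `I_n.+1); last exact: finite_II.
  by move=> i /= hi; rewrite ltnS leqNgt; apply/negP => ni; apply: h; exists i.
exists i; case: i i0 si ni => // i _ si ni; rewrite (bS hsigma) /dir si /= addn1 ltnS.
by apply: leq_trans hn _; apply: (leq_b hsigma).
Qed.

Lemma unbounded_a M : exists n, (M <= a n)%N.
Proof.
elim: M => [|M [n hn]]; first by exists 0%N.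
have [i [i0 si] ni] : exists2 i, (0 < i)%N /\ sigma i = 1 & (n < i)%N.
  apply: contrapT => h; apply: hplus.
  apply: (@sub_finite_set _ _ `I_n.+1); last exact: finite_II.
  by move=> i /= hi; rewrite ltnS leqNgt; apply/negP => ni; apply: h; exists i.
exists i; case: i i0 si ni => // i _ si ni; rewrite (aS hsigma) /dir si /= addn1 ltnS.
by apply: leq_trans hn _; apply: (leq_a hsigma).
Qed.

Lemma expr_small (e : R) : 0 < e -> forall r : R, 0 <= r -> r < 1 ->
  exists k : nat, forall n, (k <= n)%N -> r ^+ n <= e.
Proof.
move=> e0 r r0 r1.
have /cvgrPdist_le/(_ _ e0) : (r ^+ n @[n --> \oo] --> 0).
  by apply: cvg_expr; rewrite ger0_norm.
case=> k _ hk; exists k => n kn; have := hk n kn.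
by rewrite sub0r normrN /= ger0_norm // exprn_ge0.
Qed.

Lemma stay_to1 u v (e : R) : 0 < e -> exists K, forall n, (K <= n)%N ->
  [/\ (u <= a n)%N, (v <= b n)%N & 1 - e <= stay n u v].
Proof.
move=> e0.
have d0 : 0 < e / (stay_rate *+ 2 + 1).
  by rewrite divr_gt0 // ltr_wpDl // mulrn_wge0 // stay_rate_ge0.
have [k hk] := expr_small d0 (ltW q0) q1.
have [n1 h1] := unbounded_a (u + k); have [n2 h2] := unbounded_b (v + k).
exists (maxn n1 n2) => n; rewrite geq_max => /andP[n1n n2n].
have h1' := leq_trans h1 (leq_a hsigma n1n).
have h2' := leq_trans h2 (leq_b hsigma n2n).
split; first by lia.
  by lia.
apply: le_trans (expR_ge1Dx _); rewrite lerD2l lerN2.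
have A : q ^+ (a n - u)%N.+1 <= e / (stay_rate *+ 2 + 1) by apply: hk; lia.
have B : q ^+ (b n - v)%N.+1 <= e / (stay_rate *+ 2 + 1) by apply: hk; lia.
apply: (@le_trans _ _ (stay_rate * (e / (stay_rate *+ 2 + 1) *+ 2))).
  by rewrite ler_wpM2l ?stay_rate_ge0 // mulr2n lerD.
rewrite mulrnAr -mulrnAl mulrCA ger_pMr // ler_pdivrMr ?mul1r.
  by rewrite lerDl.
by rewrite ltr_wpDl // mulrn_wge0 // stay_rate_ge0.
Qed.

(** A lower bound of stay that holds even when the window reaches the edges. *)
Definition atom : R := expR (- (stay_rate *+ 2)).

Lemma atom_le n u v : atom <= stay n u v.
Proof.
rewrite ler_expR lerN2 -mulr_natr ler_wpM2l ?stay_rate_ge0 //.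
by rewrite (_ : 2%:R = 1 + 1) ?lerD ?exprn_ile1 ?ltW.
Qed.

(** * Forgetting the coordinates outside of a window *)

(** Up to an error d, the law at level k of the chain started at a high level depends
    only on the labels of the starting point in a fixed finite window. *)
Definition window_osc (d : R) : Prop :=
  forall k, exists u v K, forall n t f, (K <= n)%N -> (k <= n)%N ->
    (forall y, 0 <= f y <= 1) ->
    exists al : R, forall x, tag x = n -> agree u v t x ->
      al <= E (n - k) f x <= al + d.

Lemma window_osc1 : window_osc 1.
Proof.
move=> k; exists 0%N, 0%N, 0%N => n t f _ kn hf; exists 0 => x xn _.
rewrite add0r; apply: (expects_bounds hq hsigma (n := k)) => [y _|]; first exact: hf.
by rewrite xn subnK.
Qed.

(** A Doeblin argument. Take an intermediate level K0 so high that the window (u, v]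
    survives down to it with probability at least 1 - eta / 2, and enlarge the
    window to all labels of level K0. From every starting point that agrees with t
    there, the chain passes at level K0 through the single state y0 with labels t
    with probability at least atom; from the other states of the small window the
    expectation of f oscillates by at most d. *)
Lemma window_osc_step (d eta : R) : 0 <= d -> 0 < eta -> window_osc d ->
  window_osc ((1 - atom) * d + eta).
Proof.
move=> d0 eta0 hd k; have [u [v [K hK]]] := hd k.
have [K1 hK1] := stay_to1 u v (divr_gt0 eta0 (ltr0Sn R 1)).
pose K0 := maxn (maxn K k) K1.
have [ua vb st] : [/\ (u <= a K0)%N, (v <= b K0)%N & 1 - eta / 2 <= stay K0 u v].
  by apply: hK1; rewrite leq_maxr.
have kK0 : (k <= K0)%N by rewrite /K0; lia.
exists (a K0), (b K0), K0 => n t f nK0 kn hf.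
pose g := E (K0 - k) f.
have gE x : E (n - k) f x = E (n - K0) g x.
  by rewrite -expects_comp; congr (expects _ _ _ f x); lia.
have gb y : tag y = K0 -> 0 <= g y <= 1.
  move=> yn; apply: (expects_bounds hq hsigma (n := k)) => [z _|]; first exact: hf.
  by rewrite yn subnK.
have [al hal] := hK K0 t f ltac:(rewrite /K0; lia) kK0 hf.
pose A := agree (a K0) (b K0) t; pose B := agree u v t.
have AB y : A y -> B y by apply: agree_sub.
have PA x : tag x = n -> A x -> atom <= E (n - K0) (char_of R A) x.
  move=> xn Ax; apply: le_trans (atom_le K0 (a K0) (b K0)) _.
  by apply: expects_agree => //; rewrite xn subnK.
have PB x : tag x = n -> A x -> 1 - eta / 2 <= E (n - K0) (char_of R B) x <= 1.
  move=> xn Ax; apply/andP; split.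
    apply: le_trans st _; apply: expects_agree => //; first by rewrite xn subnK.
    exact: AB.
  have xn' : tag x = (n - K0 + K0)%N by rewrite xn subnK.
  have := expects_bounds hq hsigma (n := K0) (fun y _ => char_of_bounds R B y) xn'.
  by case/andP.
have [[y0 [y0n Ay0]]|none] := pselect (exists y0, tag y0 = K0 /\ A y0); last first.
  exists 0 => x xn Ax; exfalso.
  have := PA x xn Ax; apply/negP; rewrite -ltNge.
  apply: le_lt_trans (expR_gt0 _).
  rewrite -[leRHS](congr1 (fun f => f x) (expects_cst hq hsigma (n - K0) 0)).
  apply: (expects_le hq hsigma (n := K0)); last by rewrite xn subnK.
  by move=> y yn; rewrite /char_of; case: asboolP => // Ay; case: none; exists y.
pose ga := g y0.
have ga01 : 0 <= ga <= 1 by exact: gb.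
have gal : al <= ga <= al + d by apply: hal => //; exact: AB.
have cases (y : state) : tag y = K0 ->
    [\/ A y /\ g y = ga, [/\ ~ A y, B y & al <= g y <= al + d] | ~ A y /\ ~ B y].
  move=> yn; have [Ay|nA] := pselect (A y).
    by constructor 1; split=> //; rewrite /ga (agree_full hsigma yn y0n Ay Ay0).
  have [By|nB] := pselect (B y); last by constructor 3.
  by constructor 2; split=> //; exact: hal.
have ind1 (P : state -> Prop) y : P y -> char_of R P y = 1.
  by move=> /asboolP h; rewrite /char_of h.
have ind0 (P : state -> Prop) y : ~ P y -> char_of R P y = 0.
  by move=> h; rewrite /char_of; case: asboolP.
(* The worst case: mass atom at y0, mass eta / 2 outside of the window where f
   may vanish, and the value al on the rest. *)
exists (al + atom * (ga - al) - eta / 2) => x xn Ax; rewrite gE.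
have xn' : tag x = (n - K0 + K0)%N by rewrite xn subnK.
have pa := PA x xn Ax; have := PB x xn Ax.
set pA := E _ (char_of R A) x in pa *; set pB := E _ (char_of R B) x => pb.
have eval c1 c2 c3 : E (n - K0) (fun y => c1 * char_of R B y + (c2 * char_of R A y + c3)) x
    = c1 * pB + (c2 * pA + c3).
  by rewrite !expects_linear expects_cst.
have lo : al * pB + ((ga - al) * pA + 0) <= E (n - K0) g x.
  rewrite -eval; apply: (expects_le hq hsigma (n := K0)) xn' => y yn.
  case: (cases y yn) => [[Ay ->]|[nA By gy]|[nA nB]].
  - by rewrite (ind1 A) // (ind1 B) //; [lra | exact: AB].
  - by rewrite (ind0 A) // (ind1 B) //; lra.
  - by rewrite (ind0 A) // (ind0 B) //; have := gb y yn; lra.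
have hi : E (n - K0) g x <= (al + d - 1) * pB + ((ga - al - d) * pA + 1).
  rewrite -eval; apply: (expects_le hq hsigma (n := K0)) xn' => y yn.
  case: (cases y yn) => [[Ay ->]|[nA By gy]|[nA nB]].
  - by rewrite (ind1 A) // (ind1 B) //; [lra | exact: AB].
  - by rewrite (ind0 A) // (ind1 B) //; lra.
  - by rewrite (ind0 A) // (ind0 B) //; have := gb y yn; lra.
have p1 : (ga - al) * atom <= (ga - al) * pA by rewrite ler_wpM2l //; lra.
have p2 : (al + d - ga) * atom <= (al + d - ga) * pA by rewrite ler_wpM2l //; lra.
have p3 : al - eta / 2 <= al * pB.
  have [al0|al0] := leP 0 al.
    have : al * (1 - pB) <= 1 * (1 - pB) by rewrite ler_wpM2r //; lra.
    by lra.
  have : al * 1 <= al * pB by rewrite ler_wnM2l //; lra.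
  by lra.
have p4 : (al + d) * pB <= (al + d) * 1 by rewrite ler_wpM2l //; lra.
by apply/andP; split; lra.
Qed.

Lemma atom_gt0 : 0 < atom. Proof. exact: expR_gt0. Qed.

Lemma atom_le1 : atom <= 1.
Proof. exact: le_trans (atom_le 0 0 0) (stay_le1 0 0 0). Qed.

(** Iterating the contraction by 1 - atom. *)
Lemma window_osc_small (e : R) : 0 < e -> window_osc e.
Proof.
move=> e0; have c0 := atom_gt0; have c1 := atom_le1.
have hr r : window_osc ((1 - atom) ^+ r + e / 2).
  elim: r => [|r IH].
    move=> k; have [u [v [K h]]] := window_osc1 k; exists u, v, K => n t f Kn kn hf.
    have [al hal] := h n t f Kn kn hf; exists al => x xn Ax.
    by have := hal x xn Ax; rewrite expr0; lra.
  have -> : (1 - atom) ^+ r.+1 + e / 2 =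
      (1 - atom) * ((1 - atom) ^+ r + e / 2) + atom * e / 2 by rewrite exprS; lra.
  apply: window_osc_step => //; last by rewrite divr_gt0 ?mulr_gt0.
  by rewrite addr_ge0 ?exprn_ge0 ?divr_ge0 ?subr_ge0 // ltW.
have [r hr'] : exists r, (1 - atom) ^+ r <= e / 2.
  have r0 : 0 <= 1 - atom by lra.
  have r1 : 1 - atom < 1 by lra.
  have [r h] := expr_small (divr_gt0 e0 (ltr0Sn R 1)) r0 r1.
  by exists r; exact: h.
move=> k; have [u [v [K h]]] := hr r k; exists u, v, K => n t f Kn kn hf.
have [al hal] := h n t f Kn kn hf; exists al => x xn Ax.
by have := hal x xn Ax; lra.
Qed.

(** * Stabilizing sequences *)

Definition truncation (t : int -> int) (n : nat) : GT n :=
  mkGT (fun j : 'I_n => t ((b n)%:Z - j%:Z)).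

Lemma lab_truncation t n (i : int) : {homo t : i j / i <= j} ->
  - (a n)%:Z < i -> i <= (b n)%:Z -> lab sigma (Tagged GT (truncation t n)) i = t i.
Proof.
move=> th ai ib; have [k ke] : exists k : nat, (b n)%:Z - i = k.
  by exists `|((b n)%:Z - i)%R|%N; lia.
have kn : (k < n)%N by have := abE hsigma n; lia.
rewrite (labE _ ke) -[k]/(nat_of_ord (Ordinal kn)) -tnth_nth mkGTE //=.
  by congr t; lia.
by move=> j l jl; apply: th; lia.
Qed.

Lemma truncation_agree t n u v : {homo t : i j / i <= j} -> (u <= a n)%N -> (v <= b n)%N ->
  agree u v t (Tagged GT (truncation t n)).
Proof. by move=> th ua vb i ui iv; apply: lab_truncation => //; lia. Qed.

Definition stabilizing (t : int -> int) (lam : forall N, GT N) : Prop :=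
  forall i, \forall N \near \oo, lab sigma (Tagged GT (lam N)) i = t i.

Lemma truncation_stabilizing t : {homo t : i j / i <= j} -> stabilizing t (truncation t).
Proof.
move=> th i; have [K hK] := stay_to1 (`|i|%N.+1) `|i|%N (@ltr01 R).
exists K => // n Kn /=; have [ua vb _] := hK n Kn.
by apply: lab_truncation => //; lia.
Qed.

Lemma stabilizing_agree t lam u v : stabilizing t lam ->
  \forall N \near \oo, agree u v t (Tagged GT (lam N)).
Proof.
move=> h.
have : \forall N \near \oo, forall k : 'I_(u + v),
    lab sigma (Tagged GT (lam N)) (k%:Z - u%:Z + 1) = t (k%:Z - u%:Z + 1).
  by apply: filter_forall => k; exact: h.
apply: filterS => N hN i ui iv.
have [k ke] : exists k : nat, i = k%:Z - u%:Z + 1.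
  by exists `|(i + u%:Z - 1)%R|%N; lia.
have kn : (k < u + v)%N by lia.
by have := hN (Ordinal kn); rewrite ke.
Qed.

(** For a sequence that stabilizes to t, the chain started at a high level N passes
    level n in the window with labels t with high probability, and from there
    its law at level k is nearly the one started at the truncation of t. The
    estimate is uniform over test functions, i.e., in total variation, which
    prevents mass from escaping to infinity in the limit. *)
Lemma stabilizing_approx t k (e : R) : {homo t : i j / i <= j} -> 0 < e ->
  exists2 n, (k <= n)%N & forall lam, stabilizing t lam ->
    \forall N \near \oo, forall f, (forall y, 0 <= f y <= 1) ->
      `|E (N - k) f (Tagged GT (lam N)) - E (n - k) f (Tagged GT (truncation t n))| <= e.
Proof.
move=> th e0; have e20 : 0 < e / 2 by rewrite divr_gt0.
have [u [v [K hK]]] := window_osc_small e20 k.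
have [K1 hK1] := stay_to1 u v e20.
pose n := maxn (maxn K k) K1.
have [ua vb st] := hK1 n (leq_maxr _ _).
have kn : (k <= n)%N by rewrite /n; lia.
exists n => // lam hlam; near=> N => f hf.
have nN : (n <= N)%N by near: N; exact: nbhs_infty_ge.
have ag : agree u v t (Tagged GT (lam N)) by near: N; exact: stabilizing_agree.
have -> : (N - k = (N - n) + (n - k))%N by lia.
rewrite expects_comp; set g := E (n - k) f.
have [al hal] := hK n t f ltac:(rewrite /n; lia) kn hf.
have gb y : tag y = n -> 0 <= g y <= 1.
  move=> yn; apply: (expects_bounds hq hsigma (n := k)) => [z _|]; first exact: hf.
  by rewrite yn subnK.
set y0 := Tagged GT (truncation t n).
have g0 : al <= g y0 <= al + e / 2 by apply: hal => //; exact: truncation_agree.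
have g01 := gb y0 erefl.
have xn : tag (Tagged GT (lam N)) = (N - n + n)%N by rewrite subnK.
have pB := expects_agree xn ua vb ag.
set x := Tagged GT (lam N) in xn pB *.
set B := char_of R (agree u v t) in pB.
have eval c1 c2 : E (N - n) (fun y => c1 * B y + c2) x = c1 * E (N - n) B x + c2.
  by rewrite expects_linear expects_cst.
have cases (y : state) : tag y = n -> (B y = 1 /\ al <= g y <= al + e / 2) \/ B y = 0.
  move=> yn; rewrite /B /char_of; case: asboolP => By; last by right.
  by left; split=> //; exact: hal.
have hi : E (N - n) g x <= -1 * E (N - n) B x + (g y0 + e / 2 + 1).
  rewrite -eval; apply: (expects_le hq hsigma (n := n)) xn => y yn.
  by have := gb y yn; case: (cases y yn) => [[-> ?]|->]; lra.
have lo : 1 * E (N - n) B x + (g y0 - e / 2 - 1) <= E (N - n) g x.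
  rewrite -eval; apply: (expects_le hq hsigma (n := n)) xn => y yn.
  by have := gb y yn; case: (cases y yn) => [[-> ?]|->]; lra.
by rewrite ler_norml; apply/andP; split; lra.
Unshelve. all: by end_near.
Qed.

End Coupling.

(** * Sums over finite families and their suprema *)

Lemma cvg_sum_seq (R : realType) (I : Type) (r : seq I) (P : pred I)
    (u : I -> nat -> R) (l : I -> R) :
  (forall i, u i N @[N --> \oo] --> l i) ->
  \sum_(i <- r | P i) u i N @[N --> \oo] --> \sum_(i <- r | P i) l i.
Proof.
move=> h; elim: r => [|i r IH].
  by rewrite big_nil; under eq_fun do rewrite big_nil; exact: cvg_cst.
rewrite big_cons; under eq_fun do rewrite big_cons.
by case: (P i) => //; apply: cvgD.
Qed.

Section FiniteSums.
Variables (R : realType) (T : choiceType) (F : T -> R).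
Local Open Scope ereal_scope.

Lemma fsets_seq (X : set T) : finite_set X ->
  exists2 s, uniq s & \sum_(x \in X) (F x)%:E = (\sum_(x <- s) F x)%R%:E.
Proof.
move=> /finite_seqP[s ->]; exists (undup s); first exact: undup_uniq.
have -> : [set` s] = [set` undup s] by apply/seteqP; split=> x /=; rewrite mem_undup.
by rewrite -fsbig_seq ?undup_uniq // sumEFin.
Qed.

Lemma esum_eq_fin (l : R) :
  (forall s, uniq s -> (\sum_(x <- s) F x <= l)%R) ->
  (forall e : R, (0 < e)%R -> exists2 s, uniq s & (l - e <= \sum_(x <- s) F x)%R) ->
  \esum_(x in [set: T]) (F x)%:E = l%:E.
Proof.
move=> ub lb; apply/eqP; rewrite eq_le; apply/andP; split.
  apply: ge_ereal_sup => _ [X [fX _] <-].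
  by have [s us ->] := fsets_seq fX; rewrite lee_fin ub.
apply/lee_addgt0Pr => e e0; have [s us h] := lb e e0.
rewrite -leeBlDr // -EFinB; apply: esum_ge; exists [set` s].
  by split=> //; exact: finite_seq.
by rewrite -fsbig_seq // sumEFin lee_fin.
Qed.

Lemma esum_fin_ub (l : R) s : \esum_(x in [set: T]) (F x)%:E = l%:E -> uniq s ->
  (\sum_(x <- s) F x <= l)%R.
Proof.
move=> h us; rewrite -lee_fin -h; apply: esum_ge; exists [set` s].
  by split=> //; exact: finite_seq.
by rewrite -fsbig_seq // sumEFin.
Qed.

Lemma esum_fin_lb (l e : R) : \esum_(x in [set: T]) (F x)%:E = l%:E -> (0 < e)%R ->
  exists2 s, uniq s & (l - e <= \sum_(x <- s) F x)%R.
Proof.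
move=> h e0; apply: contrapT => hn.
have : \esum_(x in [set: T]) (F x)%:E <= (l - e)%:E.
  apply: ge_ereal_sup => _ [X [fX _] <-].
  have [s us ->] := fsets_seq fX; rewrite lee_fin leNgt; apply/negP => lt.
  by apply: hn; exists s => //; exact: ltW.
by rewrite h lee_fin; lra.
Qed.

End FiniteSums.

(** * Limits of the laws *)

Section Boundary.
Variables (R : realType) (q : R) (sigma : nat -> int).
Hypothesis hq : 0 < q < 1.
Hypothesis hsigma : forall i : nat, (0 < i)%N -> sigma i = 1 \/ sigma i = -1.
Hypothesis hplus : infinite_set [set i : nat | (0 < i)%N /\ sigma i = 1].
Hypothesis hminus : infinite_set [set i : nat | (0 < i)%N /\ sigma i = -1].

Notation E := (expects q sigma).
Notation a := (pluses sigma).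
Notation b := (Defs.b sigma).
Notation agree := (agree sigma).
Notation lab := (lab sigma).
Notation truncation := (truncation sigma).
Notation stabilizing := (stabilizing sigma).

Definition law (lam : forall N, GT N) (k : nat) (f : state -> R) (N : nat) : R :=
  E (N - k) f (Tagged GT (lam N)).

Definition at_state k (mu : GT k) : state -> R := char_of R (eq^~ (Tagged GT mu)).

Lemma at_state_bounds k (mu : GT k) y : 0 <= at_state mu y <= 1.
Proof. exact: char_of_bounds. Qed.

Lemma at_stateE k (mu nu : GT k) : at_state mu (Tagged GT nu) = (nu == mu)%:R.
Proof.
rewrite /at_state /char_of; congr (nat_of_bool _)%:R.
by apply/asboolP/eqP => [/eqP|->//]; rewrite eq_Tagged => /eqP.
Qed.

Definition converges_to (lam : forall N, GT N) (M : system R) : Prop :=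
  forall k (mu : GT k.+1), law lam k.+1 (at_state mu) N @[N --> \oo] --> M k mu.

Lemma links_cvg lam k (mu : GT k.+1) (l : R) :
  (@links R q sigma k.+1 m (lam (m + k.+1)%N) mu @[m --> \oo] --> l) =
  (law lam k.+1 (at_state mu) N @[N --> \oo] --> l).
Proof.
have -> : (fun m => links q sigma (lam (m + k.+1)%N) mu) =
    (fun m => law lam k.+1 (at_state mu) (m + k.+1)%N).
  by apply/funext => m; rewrite (links_expects hq hsigma) /law /= addnK.
by rewrite -[RHS](cvg_shiftn k.+1).
Qed.

Lemma links_converges lam (M : system R) :
  (forall k (mu : GT k.+1),
     @links R q sigma k.+1 m (lam (m + k.+1)%N) mu @[m --> \oo] --> M k mu) <->
  converges_to lam M.
Proof. by split=> h k mu; have := h k mu; rewrite links_cvg. Qed.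

Definition limit_law (t : int -> int) k f : R := lim (law (truncation t) k f @ \oo).

(** Approximation by one and the same state y0 for all stabilizing sequences makes
    the laws Cauchy and forces all of them to have the same limit. *)
Lemma law_cvg t lam k f : {homo t : i j / i <= j} -> stabilizing t lam ->
  (forall y, 0 <= f y <= 1) -> law lam k f N @[N --> \oo] --> limit_law t k f.
Proof.
move=> th hlam hf.
have approx := stabilizing_approx hq hsigma hplus hminus k th.
have tr := truncation_stabilizing hq hsigma hplus hminus th.
have cv : cvg (law (truncation t) k f @ \oo).
  apply: cauchy_cvg; apply: cauchy_exP => e e0.
  have e20 : 0 < e / 2 by rewrite divr_gt0.
  have [n kn h] := approx _ e20; exists (E (n - k) f (Tagged GT (truncation t n))).
  apply: filterS (h _ tr) => N /(_ f hf); rewrite /ball /= distrC => /le_lt_trans.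
  by apply; rewrite ltr_pdivrMr // mulr_natr mulr2n ltrDl.
apply/cvgrPdist_le => e e0; have e30 : 0 < e / 3%:R by rewrite divr_gt0.
have [n kn h] := approx _ e30.
move/cvgrPdist_le : (cv) => /(_ _ e30) c1.
apply: filterS3 c1 (h _ tr) (h _ hlam) => N; rewrite -/(limit_law t k f).
move=> + /(_ f hf) + /(_ f hf); rewrite /law.
set v := E (n - k) _ _; rewrite !ler_norml => /andP[? ?] /andP[? ?] /andP[? ?].
by apply/andP; split; lra.
Qed.

Definition limit_system (t : int -> int) : system R :=
  fun k mu => limit_law t k.+1 (at_state mu).

Arguments limit_system : clear implicits.

Lemma stabilizing_converges t lam : {homo t : i j / i <= j} -> stabilizing t lam ->
  converges_to lam (limit_system t).
Proof. by move=> th h k mu; apply: law_cvg => // y; exact: at_state_bounds. Qed.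

(** The definition of Mt picks a value by choice; the truncations of t show that there is
    only one value to pick. *)
Lemma MtE t : {homo t : i j / i <= j} -> Mt q sigma t = limit_system t.
Proof.
move=> th; apply: functional_extensionality_dep => k; apply/funext => mu.
have tr := truncation_stabilizing hq hsigma hplus hminus th.
rewrite /Mt; apply: get_unique => [lam hlam|l hl].
  by rewrite links_cvg; exact: stabilizing_converges.
have := hl _ tr; rewrite links_cvg => h.
have h2 : law (truncation t) k.+1 (at_state mu) N @[N --> \oo] --> limit_system t k mu.
  exact: stabilizing_converges.
exact: (@cvg_unique _ (@Rhausdorff R) _ _ _ _ h h2).
Qed.

Lemma converges_unique lam M M' : converges_to lam M -> converges_to lam M' -> M = M'.
Proof.
move=> h h'; apply: functional_extensionality_dep => k; apply/funext => mu.
exact: (cvg_unique _ (h k mu) (h' k mu)).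
Qed.

(** * Coherence of the limits *)

Definition comb k (s : seq (GT k)) (c : GT k -> R) : state -> R :=
  fun y => \sum_(mu <- s) c mu * at_state mu y.

Lemma expects_comb m k (s : seq (GT k)) c x :
  E m (comb s c) x = \sum_(mu <- s) c mu * E m (at_state mu) x.
Proof.
rewrite /comb; elim: s => [|mu s IH].
  under eq_fun do rewrite big_nil; by rewrite big_nil (expects_cst hq hsigma).
under eq_fun do rewrite big_cons; by rewrite big_cons expects_linear IH.
Qed.

Lemma combE k (s : seq (GT k)) c (nu : GT k) : uniq s ->
  comb s c (Tagged GT nu) = if nu \in s then c nu else 0.
Proof.
move=> us; rewrite /comb; under eq_bigr do rewrite at_stateE.
case: ifP => [ns|/negP ns].
  rewrite (bigD1_seq nu) //= eqxx mulr1 big1 ?addr0 // => mu.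
  by rewrite eq_sym => /negPf ->; rewrite mulr0.
rewrite big_seq big1 // => mu mus; case: eqP => [e|_]; last by rewrite mulr0.
by case: ns; rewrite e.
Qed.

Lemma comb1_bounds k (s : seq (GT k)) y : uniq s -> 0 <= comb s (fun=> 1) y <= 1.
Proof.
move=> us; case: y => N lam; have [eN|ne] := eqVneq N k.
  by subst N; rewrite combE //; case: ifP; rewrite ?lexx ?ler01.
rewrite /comb big1 ?lexx ?ler01 // => mu _; rewrite /at_state /char_of.
by case: asboolP => [/(congr1 tag) /= eN|_]; [rewrite eN eqxx in ne | rewrite mulr0].
Qed.

Lemma law_comb_cvg lam M k (s : seq (GT k.+1)) c : converges_to lam M ->
  law lam k.+1 (comb s c) N @[N --> \oo] --> \sum_(mu <- s) c mu * M k mu.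
Proof.
move=> h; rewrite /law; under eq_fun do rewrite expects_comb.
by apply: cvg_sum_seq => mu; apply: cvgMl_tmp; exact: h.
Qed.

Lemma law_le lam k f g : (forall y, tag y = k -> f y <= g y) ->
  \forall N \near \oo, law lam k f N <= law lam k g N.
Proof.
move=> fg; near=> N; apply: (expects_le hq hsigma fg) => /=.
by rewrite subnK //; near: N; exact: nbhs_infty_ge.
Unshelve. all: by end_near.
Qed.

Lemma law_cst lam k c N : law lam k (fun=> c) N = c.
Proof. by rewrite /law (expects_cst hq hsigma). Qed.

Lemma law_ge lam k f c : (forall y, tag y = k -> c <= f y) ->
  \forall N \near \oo, c <= law lam k f N.
Proof. by move=> h; apply: filterS (@law_le lam k (fun=> c) f h) => N; rewrite law_cst. Qed.

Lemma law_leC lam k f c : (forall y, tag y = k -> f y <= c) ->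
  \forall N \near \oo, law lam k f N <= c.
Proof. by move=> h; apply: filterS (@law_le lam k f (fun=> c) h) => N; rewrite law_cst. Qed.

Lemma law_expect lam k f : \forall N \near \oo,
  law lam k.+1 (expect q sigma f) N = law lam k f N.
Proof.
near=> N; have kN : (k < N)%N by near: N; exact: nbhs_infty_gt.
by rewrite /law /expects -iterSr subnSK.
Unshelve. all: by end_near.
Qed.

Lemma converges_ge0 lam M : converges_to lam M -> forall k mu, 0 <= M k mu.
Proof.
move=> h k mu; apply: (cvgr_to_ge (h k mu)); apply: law_ge => y _.
by case/andP: (at_state_bounds mu y).
Qed.

(** Laws at lower levels have finite support, since only finitely many signatures lie
    below a given one. *)
Lemma expects_support k m (x : state) : tag x = (m + k)%N ->
  exists s : seq (GT k), forall f g : state -> R,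
    (forall mu, mu \in s -> f (Tagged GT mu) = g (Tagged GT mu)) -> E m f x = E m g x.
Proof.
elim: m x => [|m IH] x.
  case: x => N lam /= e; subst N; exists [:: lam] => f g h.
  by apply: h; rewrite inE.
case: x => N lam /= e; subst N.
have [s hs] := choice (fun nu : GT (m + k) => IH (Tagged GT nu) erefl).
exists (flatten [seq s nu | nu <- below lam]) => f g h /=.
apply: eq_big_seq => nu nul; congr (_ * _); apply: hs => mu mus; apply: h.
by apply/flattenP; exists (s nu) => //; apply: map_f.
Qed.

(** No mass escapes: the law at level k is close in total variation to the one started
    at a truncation of t, whose support is finite. *)
Lemma limit_system_mass t k (e : R) : {homo t : i j / i <= j} -> 0 < e ->
  exists2 s, uniq s & 1 - e <= \sum_(mu <- s) limit_system t k mu.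
Proof.
move=> th e0.
have [n kn h] := stabilizing_approx hq hsigma hplus hminus k.+1 th e0.
have tr := truncation_stabilizing hq hsigma hplus hminus th.
have yn : tag (Tagged GT (truncation t n)) = (n - k.+1 + k.+1)%N.
  by rewrite /= subnK.
have [s hs] := expects_support yn.
exists (undup s); first exact: undup_uniq.
have := @law_comb_cvg _ _ k (undup s) (fun=> 1) (stabilizing_converges th tr).
under [X in _ --> X]eq_bigr do rewrite mul1r.
move=> cv; apply: (cvgr_to_ge cv).
pose f := comb (undup s) (fun=> 1).
have f01 y : 0 <= f y <= 1 by apply: comb1_bounds; exact: undup_uniq.
apply: filterS (h _ tr) => N /(_ f f01).
rewrite [E (n - k.+1) _ _](hs _ (fun=> 1)); last first.
  by move=> mu mus; rewrite /f combE ?undup_uniq // mem_undup mus.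
by rewrite (expects_cst hq hsigma) -/(law _ _ _ _) ler_norml => /andP[? ?]; lra.
Qed.

Lemma sum_mass_le1 lam M k (s : seq (GT k.+1)) : converges_to lam M -> uniq s ->
  \sum_(mu <- s) M k mu <= 1.
Proof.
move=> h us; have := @law_comb_cvg lam M k s (fun=> 1) h.
under [X in _ --> X]eq_bigr do rewrite mul1r.
move=> cv; apply: (cvgr_to_le cv).
apply: law_leC => -[N nu] /= e; subst N; rewrite combE //.
by case: ifP; rewrite ?lexx ?ler01.
Qed.

Lemma law_expect_at_state lam M k (mu : GT k.+1) : converges_to lam M ->
  law lam k.+2 (expect q sigma (at_state mu)) N @[N --> \oo] --> M k mu.
Proof.
move=> h; apply: cvg_trans (h k mu); apply: near_eq_cvg.
by apply: filterS (law_expect lam k.+1 (at_state mu)) => N ->.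
Qed.

Lemma expect_at_state k (lam : GT k.+1) (mu : GT k) :
  expect q sigma (at_state mu) (Tagged GT lam) = link q sigma lam mu.
Proof.
rewrite /expect /=; under eq_bigr do rewrite at_stateE.
case: (boolP (mu \in below lam)) => [h|h].
  rewrite (bigD1_seq mu) ?below_uniq //= eqxx mulr1 big1 ?addr0 // => nu /negPf ->.
  by rewrite mulr0.
rewrite (link_out hq hsigma h) big_seq big1 // => nu nul.
by case: eqP => [e|_]; [rewrite e (negPf h) in nul | rewrite mulr0].
Qed.

(** The relation of coherence holds before the limit, where one more step of the chain
    does not change the law. In the limit the sum over lam is bounded above by its
    partial sums, and below because these carry nearly all the mass. *)
Lemma limit_system_coherent t : {homo t : i j / i <= j} ->
  coherent q sigma (limit_system t).
Proof.
move=> th; have tr := truncation_stabilizing hq hsigma hplus hminus th.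
have cv := stabilizing_converges th tr.
have ge0 := converges_ge0 cv.
split => // [N|N mu].
  apply: esum_eq_fin => // [s us|e e0]; first exact: (sum_mass_le1 cv).
  exact: limit_system_mass.
have lim s : uniq s ->
    law (truncation t) N.+2 (comb s (fun lam => link q sigma lam mu)) n @[n --> \oo]
    --> \sum_(lam <- s) limit_system t N.+1 lam * link q sigma lam mu.
  move=> us; under [X in _ --> X]eq_bigr do rewrite mulrC.
  exact: (@law_comb_cvg _ _ N.+1).
have pt : law (truncation t) N.+2 (expect q sigma (at_state mu)) n @[n --> \oo] -->
    limit_system t N mu by exact: law_expect_at_state.
apply: esum_eq_fin => // [s us|e e0].
  apply: (ler_cvg_to (lim s us) pt); apply: law_le => -[M lam] eM.
  have {}eM : M = N.+2 := eM; subst M.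
  rewrite combE // expect_at_state.
  by case: ifP => // _; exact: link_ge0.
have [s us hs] := limit_system_mass N.+1 th e0; exists s => //.
have l1 := @law_comb_cvg _ _ N.+1 s (fun=> 1) cv.
(* The one-step expectation is at most 1 off s, and at s it is the link. *)
pose g y := -1 * comb s (fun=> 1) y + (comb s (fun lam => link q sigma lam mu) y + 1).
have l2 : law (truncation t) N.+2 g n @[n --> \oo] -->
    -1 * (\sum_(lam <- s) 1 * limit_system t N.+1 lam) +
    (\sum_(lam <- s) limit_system t N.+1 lam * link q sigma lam mu + 1).
  rewrite /law /g; under eq_fun do
    rewrite expects_linear expectsD (expects_cst hq hsigma).
  by apply: cvgD; [exact: cvgMl_tmp | apply: cvgD (lim s us) _; exact: cvg_cst].
have : limit_system t N mu <= -1 * (\sum_(lam <- s) 1 * limit_system t N.+1 lam) +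
    (\sum_(lam <- s) limit_system t N.+1 lam * link q sigma lam mu + 1).
  apply: (ler_cvg_to pt l2); apply: law_le => -[M lam] eM.
  have {}eM : M = N.+2 := eM; subst M.
  rewrite expect_at_state /g !combE //.
  case: ifP => _; first lra.
  rewrite mulr0 !add0r; have := sum_link hq hsigma lam; have := link_ge0 hq hsigma lam.
  case: (boolP (mu \in below lam)) => [h h0 <-|/(link_out hq hsigma) -> //].
  by rewrite (bigD1_seq mu) ?below_uniq //= lerDl sumr_ge0.
move: hs; under [X in _ <= X -> _]eq_bigr do rewrite -[limit_system _ _ _]mul1r.
by lra.
Qed.

(** * Recovering the sequence from its limit *)

Lemma window_label (i : int) : - (`|i|%N.+1)%:Z < i /\ i <= `|i|%N%:Z.
Proof. by split; lia. Qed.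

(** At a fixed high level the part with label i equals that of the starting signature
    with probability close to 1, uniformly in the starting signature. As M is a
    probability measure, this passes to the limit: M gives more than half of its
    mass on a finite set s to the signatures with the same part as lam N, for all
    large N. *)
Lemma label_determined M (i : int) : coherent q sigma M ->
  exists k (s : seq (GT k.+1)), uniq s /\ forall lam, converges_to lam M ->
    \forall N \near \oo, 2^-1 <
      \sum_(mu <- s | lab (Tagged GT mu) i == lab (Tagged GT (lam N)) i) M k mu.
Proof.
move=> [M0 M1 _]; have e0 : 0 < 16%:R^-1 :> R by rewrite invr_gt0.
pose u := `|i|%N.+1; pose v := `|i|%N.
have [k hk] := stay_to1 hq hsigma hplus hminus u v e0.
have [s us hs] := esum_fin_lb (M1 k) e0.
exists k, s; split=> // lam cv.
have [ua vb st] := hk k.+1 (leqnSn k).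
(* The number of terms of s times d stays below 1/8. *)
pose d : R := (8%:R * ((size s)%:R + 1))^-1.
have d0 : 0 < d by rewrite invr_gt0 mulr_gt0 // ltr_wpDl.
have dle : d *+ size s <= 8%:R^-1.
  have -> : d *+ size s = 8%:R^-1 * ((size s)%:R / ((size s)%:R + 1)).
    by rewrite /d invfM -[LHS]mulr_natr -mulrA [_^-1 * _%:R]mulrC.
  by rewrite ler_piMr ?invr_ge0 // ler_pdivrMr ?ltr_wpDl // mul1r lerDl.
have close : forall r : seq (GT k.+1), \forall N \near \oo, forall mu, mu \in r ->
    `|M k mu - law lam k.+1 (at_state mu) N| <= d.
  elim=> [|mu r IH]; first by exists 0%N.
  move/cvgrPdist_le : (cv k mu) => /(_ _ d0); apply: filterS2 IH => N h h1 nu.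
  by rewrite inE => /orP[/eqP ->//|/h].
have lawE r N : law lam k.+1 (comb r (fun=> 1)) N =
    \sum_(mu <- r) law lam k.+1 (at_state mu) N.
  by rewrite /law expects_comb; under eq_bigr do rewrite mul1r.
have dsum (r : seq (GT k.+1)) : \sum_(mu <- r) d = d *+ size r.
  by rewrite big_const_seq count_predT iter_addr_0.
near=> N.
have kN : (k < N)%N by near: N; exact: nbhs_infty_gt.
have cl : forall mu, mu \in s -> `|M k mu - law lam k.+1 (at_state mu) N| <= d.
  by near: N; exact: close.
set x := Tagged GT (lam N).
have xn : tag x = (N - k.+1 + k.+1)%N by rewrite /= subnK.
pose A := agree u v (lab x).
have pA : stay q sigma k.+1 u v <= E (N - k.+1) (char_of R A) x.
  exact: (expects_agree hq hsigma xn ua vb).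
pose s' := [seq mu <- s | lab (Tagged GT mu) i == lab x i].
have us' : uniq s' by exact: filter_uniq.
rewrite -big_filter -/s'.
have h1 : \sum_(mu <- s) M k mu - d *+ size s <= law lam k.+1 (comb s (fun=> 1)) N.
  rewrite lawE -dsum -sumrB big_seq [leRHS]big_seq; apply: ler_sum => mu /cl.
  by rewrite ler_norml => /andP[_ h]; lra.
have h2 : law lam k.+1 (comb s' (fun=> 1)) N - d *+ size s <= \sum_(mu <- s') M k mu.
  apply: (@le_trans _ _ (law lam k.+1 (comb s' (fun=> 1)) N - d *+ size s')).
    by rewrite lerD2l lerN2 ler_wpMn2l ?(ltW d0) // size_filter count_size.
  rewrite lawE -dsum -sumrB big_seq [leRHS]big_seq; apply: ler_sum => mu.
  by rewrite mem_filter => /andP[_ /cl]; rewrite ler_norml => /andP[h _]; lra.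
have h3 : 1 * law lam k.+1 (comb s (fun=> 1)) N +
    (1 * E (N - k.+1) (char_of R A) x - 1) <= law lam k.+1 (comb s' (fun=> 1)) N.
  have -> : 1 * E (N - k.+1) (char_of R A) x - 1 =
      E (N - k.+1) (fun y => 1 * char_of R A y + -1) x.
    by rewrite expects_linear (expects_cst hq hsigma).
  have := expects_linear q sigma (N - k.+1) 1 (comb s (fun=> 1))
    (fun y => 1 * char_of R A y + -1).
  move=> /(congr1 (fun f => f x)) <-.
  apply: (expects_le hq hsigma) xn => -[K mu] /= eK; subst K.
  rewrite !combE // mem_filter /char_of; case: asboolP => Ax; last first.
    by case: (mu \in s); case: eqP => _ /=; lra.
  have [i1 i2] := window_label i.
  by rewrite (Ax i i1 i2) eqxx /=; case: ifP => _; lra.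
by lra.
Unshelve. all: by end_near.
Qed.

(** Two disjoint sets of signatures cannot both carry more than half of the mass. For
    lam' = lam this shows that the parts of lam with label i are eventually
    constant; for two sequences, that their eventual values agree. *)
Lemma labels_agree M lam lam' (i : int) : coherent q sigma M ->
  converges_to lam M -> converges_to lam' M ->
  exists c, (\forall N \near \oo, lab (Tagged GT (lam N)) i = c) /\
            (\forall N \near \oo, lab (Tagged GT (lam' N)) i = c).
Proof.
move=> coh cv cv'; have [M0 M1 _] := coh.
have [k [s [us hs]]] := label_determined i coh.
have unique c c' : 2^-1 < \sum_(mu <- s | lab (Tagged GT mu) i == c) M k mu ->
    2^-1 < \sum_(mu <- s | lab (Tagged GT mu) i == c') M k mu -> c = c'.
  move=> h h'; apply/eqP; apply: contraT => ne.
  have := esum_fin_ub (M1 k) us.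
  rewrite (bigID (fun mu => lab (Tagged GT mu) i == c)) /=.
  rewrite [X in _ + X](bigID (fun mu : GT k.+1 => lab (Tagged GT mu) i == c')) /=.
  have -> : \sum_(mu <- s | (lab (Tagged GT mu) i != c) &&
        (lab (Tagged GT mu) i == c')) M k mu =
      \sum_(mu <- s | lab (Tagged GT mu) i == c') M k mu.
    apply: eq_bigl => mu; case: (eqVneq (lab _ i) c') => [->|_]; last by rewrite andbF.
    by rewrite andbT eq_sym.
  set rest := \sum_(_ <- s | _ && (_ != c')) _.
  have : 0 <= rest by apply: sumr_ge0.
  by lra.
have [N [_ hN]] : exists N, True /\ 2^-1 <
    \sum_(mu <- s | lab (Tagged GT mu) i == lab (Tagged GT (lam N)) i) M k mu.
  have [N0 _ h] := hs _ cv; exists N0; split=> //; exact: (h N0 (leqnn _)).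
exists (lab (Tagged GT (lam N)) i); split.
  by apply: filterS (hs _ cv) => n hn; exact: unique hn hN.
by apply: filterS (hs _ cv') => n hn; exact: unique hn hN.
Qed.

Lemma homo_labels (lam : forall N, GT N) t : stabilizing t lam -> {homo t : i j / i <= j}.
Proof.
move=> h i j ij.
pose u := (`|i|%N + `|j|%N).+1.
have [K hK] := stay_to1 hq hsigma hplus hminus u u (@ltr01 R).
have : \forall N \near \oo, t i <= t j.
  near=> N.
  have [ua vb _] : [/\ (u <= a N)%N, (u <= b N)%N & 1 - 1 <= stay q sigma N u u].
    by apply: hK; near: N; exact: nbhs_infty_ge.
  have <- : lab (Tagged GT (lam N)) i = t i by near: N; exact: h.
  have <- : lab (Tagged GT (lam N)) j = t j by near: N; exact: h.
  have [x xe] : exists x : nat, (b N)%:Z - i = x.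
    by exists `|((b N)%:Z - i)%R|%N; lia.
  have [y ye] : exists y : nat, (b N)%:Z - j = y.
    by exists `|((b N)%:Z - j)%R|%N; lia.
  rewrite (labE _ xe) (labE _ ye); apply: GT_geP.
  by have := abE hsigma N; lia.
by case=> N _ /(_ N (leqnn N)).
Unshelve. all: by end_near.
Qed.

Lemma Mt_in_boundary : set_fun frakX (martin_boundary q sigma) (Mt q sigma).
Proof.
move=> t th; rewrite MtE //; split; first exact: limit_system_coherent.
exists (truncation t); apply/links_converges; apply: stabilizing_converges => //.
exact: (truncation_stabilizing hq hsigma hplus hminus th).
Qed.

Lemma Mt_injective : set_inj frakX (Mt q sigma).
Proof.
move=> t t'; rewrite !inE => th th'; rewrite !MtE // => e.
have tr := truncation_stabilizing hq hsigma hplus hminus th.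
have tr' := truncation_stabilizing hq hsigma hplus hminus th'.
have cv := stabilizing_converges th tr; have cv' := stabilizing_converges th' tr'.
rewrite -e in cv'; apply/funext => i.
have [c [h h']] := labels_agree i (limit_system_coherent th) cv cv'.
have : \forall N \near \oo, t i = t' i.
  near=> N; transitivity c.
    transitivity (lab (Tagged GT (truncation t N)) i); last by near: N.
    by symmetry; near: N; exact: tr.
  transitivity (lab (Tagged GT (truncation t' N)) i); last by near: N; exact: tr'.
  by symmetry; near: N.
by case=> N _ /(_ N (leqnn N)).
Unshelve. all: by end_near.
Qed.

Lemma Mt_surjective : set_surj frakX (martin_boundary q sigma) (Mt q sigma).
Proof.
move=> M [coh [lam /links_converges cv]].
have [t ht] := choice (fun i => labels_agree i coh cv cv).
have st : stabilizing t lam by move=> i; have [] := ht i.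
have th := homo_labels st.
exists t => //; rewrite MtE //.
exact: converges_unique (stabilizing_converges th st) cv.
Qed.

End Boundary.

Theorem theorem5p6 (R : realType) (q : R) (sigma : nat -> int)
  (hq : 0 < q < 1)
  (hsigma : forall i : nat, (0 < i)%N -> sigma i = 1 \/ sigma i = -1)
  (hplus : infinite_set [set i : nat | (0 < i)%N /\ sigma i = 1])
  (hminus : infinite_set [set i : nat | (0 < i)%N /\ sigma i = -1]) :
  set_bij frakX (martin_boundary q sigma) (Mt q sigma).
Proof.
split; first exact: Mt_in_boundary.
- exact: Mt_injective.
- exact: Mt_surjective.
Qed.
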